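(* There exists a universal constant $c_1>0$ such that, for every probability space $(M,\mathcal M,\mu)$, every measurable $V\subset M$ with $0<\mu(V)<1$, and every weakly mixing Markov kernel $P$ on $M$ reversible with respect to $\mu$, the quantities $\sigma_k(M)$ associated to the Steklov Markov kernel $K$ of $(P,V)$ satisfy $$\forall k\in\mathbb N,\qquad \sigma_k(M)\ \ge\ \frac{c_1}{k^6}\,\iota_k(M),$$ where $\iota_k(M)$ is the $k$-th Cheeger–Steklov constant.
   Context: Let $(M,\mathcal M,\mu)$ be a probability space and $P$ a Markov kernel on $M$ with $\mu(dx)P(x,dy)=\mu(dy)P(y,dx)$; $P[F](x)=\int P(x,dy)F(y)$ is a self-adjoint operator on $L^2(\mu)$. The generator is $L=P-I$. $\mathbb N=\{1,2,\dots\}$. Let $\mathcal A=\{A\in\mathcal M:\ 0<\mu(A)\le 1\}$. Let $Z=(Z(n))_{n\ge0}$ be a Markov chain with transition kernel $P$, started from $x$ under $\mathbb P_x$, and $\tau_A=\inf\{n\ge 0: Z(n)\in A\}$. $P$ is weakly mixing if $\tau_A<\infty$ $\mathbb P_x$-a.s. for all $x\in M$ and all $A\in\mathcal A$. Let $\nu$ be the normalized restriction of $\mu$ to $V$. For bounded measurable $f$ on $V$ let $F_f(x)=\mathbb E_x[f(Z(\tau_V))]$, $x\in M$, and $K[f](x)=P[F_f](x)$, $x\in V$ (the Steklov Markov kernel). $K$ extends to a bounded self-adjoint operator on $L^2(\nu)$. For $k\in\mathbb N$, $$\sigma_k=\sigma_k(M)=\inf_{H}\ \sup_{f\in H\setminus\{0\}}\frac{\nu[f(I-K)[f]]}{\nu[f^2]},$$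 the infimum being over $k$-dimensional subspaces $H$ of $L^2(\nu)$, with $\inf\emptyset=+\infty$ (and $\nu[g]=\int g\,d\nu$). For $A\in\mathcal A$: $\partial A=\{(x,y):x\in A,\ y\in M\setminus A\}$, $\underline\mu(dx,dy)=\mu(dx)P(x,dy)$ on $M\times M$, $$\eta(A)=\frac{\underline\mu(\partial A)}{\mu(A)},\qquad \eta'(A)=\frac{\underline\mu(\partial A)}{\mu(A\cap V)}\quad(\eta'(A)=+\infty\text{ if }\mu(A\cap V)=0),$$ $$\rho(A)=\inf_{B\in\mathcal A,\,B\subseteq A}\eta(B),\qquad \rho'(A)=\inf_{B\in\mathcal A,\,B\subseteq A}\eta'(B).$$ Let $\mathcal A_k$ be the set of $k$-tuples of pairwise disjoint elements of $\mathcal A$ and $$\iota_k(M)=\inf_{(A_1,\dots,A_k)\in\mathcal A_k}\ \max_{1\le l\le k}\rho(A_l)\rho'(A_l),$$ where a product $0\cdot(+\infty)$ (possible only if $\mu(A_l\cap V)=0$) is read as $+\infty$. *)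

(* Defs.v *)
From HB Require Import structures.
From mathcomp Require Import all_boot all_order all_algebra.
From mathcomp Require Import all_classical all_reals all_analysis.

Set Implicit Arguments.
Unset Strict Implicit.
Unset Printing Implicit Defensive.
Import Order.TTheory GRing.Theory Num.Theory.
Import numFieldNormedType.Exports.

Local Open Scope classical_set_scope.
Local Open Scope ring_scope.
Local Open Scope ereal_scope.

Section markov_chain.
Context d dO (R : realType) (M : measurableType d) (Omega : measurableType dO).
Implicit Types (Z : nat -> Omega -> M) (A B : set M).

Definition natural_filtration Z (n : nat) : set (set Omega) :=
  <<s \bigcup_(i in [set i | (i <= n)%N])
        preimage_set_system [set: Omega] (Z i) measurable >>.

(* Points of M need not be measurable, so the start at x is expressed through
   the law of Z 0.  No measurability of PP in its argument is required: it
   follows from the other conditions. *)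
Definition is_markov_chain (P : R.-pker M ~> M) (PP : M -> probability Omega R)
    Z : Prop :=
  [/\ forall n, measurable_fun [set: Omega] (Z n),
      forall x A, measurable A -> PP x (Z 0%N @^-1` A) = \d_x A &
      forall x n E B, natural_filtration Z n E -> measurable B ->
        PP x (E `&` Z n.+1 @^-1` B) = \int[PP x]_(w in E) P (Z n w) B].

(* None stands for +oo. *)
Definition hitting_time Z A (w : Omega) : option nat :=
  if pselect (exists n, `[< A (Z n w) >]) is left e then Some (ex_minn e)
  else None.

End markov_chain.

Section steklov.
Context d (R : realType) (M : measurableType d).
Variables (mu : probability M R) (P : R.-pker M ~> M).
Implicit Types (A B V : set M) (f g : M -> R).

(* The measure mu(dx) P(x, dy) on M * M. *)
Definition edge_measure (E : set (M * M)) : \bar R :=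
  \int[mu]_x P x (xsection E x).

Definition reversible : Prop :=
  forall E : set (M * M), measurable E ->
    edge_measure E = edge_measure [set xy | E (xy.2, xy.1)].

Definition pos_measurable A : Prop := measurable A /\ 0 < mu A <= 1.

Definition edge_boundary A : set (M * M) := [set xy | A xy.1 /\ ~ A xy.2].

Definition eta A : \bar R :=
  edge_measure (edge_boundary A) * ((fine (mu A))^-1)%:E.

Definition eta' V A : \bar R :=
  if mu (A `&` V) == 0 then +oo
  else edge_measure (edge_boundary A) * ((fine (mu (A `&` V)))^-1)%:E.

Definition rho A : \bar R :=
  ereal_inf [set eta B | B in [set B | pos_measurable B /\ B `<=` A]].

Definition rho' V A : \bar R :=
  ereal_inf [set eta' V B | B in [set B | pos_measurable B /\ B `<=` A]].

(* The product of the library has 0 * +oo = 0. *)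
Definition mule_top (x y : \bar R) : \bar R :=
  if ((x == 0) && (y == +oo)) || ((x == +oo) && (y == 0)) then +oo else x * y.

Definition disjoint_tuples (k : nat) : set ('I_k -> set M) :=
  [set A | (forall l, pos_measurable (A l)) /\ trivIset [set: 'I_k] A].

Definition cheeger_steklov V (k : nat) : \bar R :=
  ereal_inf [set \big[maxe/-oo]_(l < k) mule_top (rho (A l)) (rho' V (A l))
            | A in @disjoint_tuples k].

(* The normalized restriction of mu to V, kept as a probability on M carried
   by V: functions on V are represented by functions on M, whose values
   outside V are irrelevant modulo nu-a.e. equality.  The second argument of
   mnormalize is only used when mu V = 0. *)
Definition steklov_nu V (mV : measurable V) : probability M R :=
  mnormalize (mrestr mu mV) mu.

Definition weakly_mixing dO (Omega : measurableType dO)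
    (PP : M -> probability Omega R) (Z : nat -> Omega -> M) : Prop :=
  forall x A, pos_measurable A ->
    PP x [set w | hitting_time Z A w != None] = 1.

(* F_f(x) = E_x[f(Z(tau_V))]; the value 0 on {tau_V = +oo} plays no role when
   P is weakly mixing and mu V > 0. *)
Definition hitting_extension dO (Omega : measurableType dO)
    (PP : M -> probability Omega R) (Z : nat -> Omega -> M) V f (x : M) : R :=
  (\int[PP x]_w
     (if hitting_time Z V w is Some n then f (Z n w) else 0))%R.

(* K is the integral operator of the Markov kernel
   kappa(x, B) = P[F_(1_B)](x), which leaves nu invariant.  Hence for f in
   L^2(nu) both integrals below converge absolutely for nu-a.e. x (for the inner
   one, for P x-a.e. y), K f depends only on the nu-a.e. class of f, and by
   Jensen's inequality K is a contraction of L^2(nu): on L^2(nu) the formula is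
   the unique bounded extension of K from bounded measurable functions. *)
Definition steklov_kernel dO (Omega : measurableType dO)
    (PP : M -> probability Omega R) (Z : nat -> Omega -> M) V f (x : M) : R :=
  (\int[P x]_y hitting_extension PP Z V f y)%R.

End steklov.

Section minmax.
Context d (R : realType) (M : measurableType d).
Variables (nu : probability M R) (K : (M -> R) -> M -> R).
Implicit Types f : M -> R.

(* L^2(nu) is handled through representatives: H is saturated for nu-a.e.
   equality, and its image in L^2(nu) is the span of k vectors linearly
   independent in L^2(nu). *)
Definition subspace_L2 (k : nat) (H : set (M -> R)) : Prop :=
  exists b : 'I_k -> M -> R,
    [/\ forall i, b i \in Lfun nu 2%:E,
        forall c : 'I_k -> R,
          {ae nu, forall x, (\sum_(i < k) c i * b i x = 0)%R} ->
          forall i, c i = 0%R &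
        H = [set f | f \in Lfun nu 2%:E /\
              exists c : 'I_k -> R,
                {ae nu, forall x, f x = (\sum_(i < k) c i * b i x)%R}]].

Definition rayleigh f : R :=
  ((\int[nu]_x (f x * (f x - K f x))) / (\int[nu]_x (f x ^+ 2)))%R.

Definition minmax_sigma (k : nat) : \bar R :=
  ereal_inf
    [set ereal_sup
           [set (rayleigh f)%:E
           | f in [set f | H f /\ ~ {ae nu, forall x, f x = 0%R}]]
    | H in subspace_L2 k].

End minmax.

(* Main.v *)
(** Let f_1, ..., f_k be an orthonormal basis of a test space, cut off at a high
    level, and let F_i be the extension of f_i by its mean at the hitting time
    of V.  F_i is P-harmonic off V, so its Dirichlet energy only sees V and
    equals twice the quadratic form of I - K at f_i; the cutoff is removed by
    dominated convergence.

    Write r = |(F_1, ..., F_k)| and cut the range of the direction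
    (F_1, ..., F_k) / r into the cells of a grid of R^k whose side is of order
    1/k.  By orthonormality a cell carries at most about 1/k of the total mass
    of r^2 on V.  Averaging over the shifts of the grid, separately in each
    coordinate, gives a shift for which little mass lies near the walls and for
    which the cutoff function of the walls costs little energy.  Grouping cells
    greedily yields k disjointly supported functions psi, each with a fixed
    part of the mass on V and energy O(k^5) times the Rayleigh quotient.

    Finally rho rho' of the support of psi is at most a multiple of its
    energy over its mass on V: apply the coarea formula to psi^2, once against
    mu and once against the restriction of mu to V. *)

Require Import Defs.
From mathcomp Require Import all_boot all_order all_algebra.
From mathcomp Require Import all_classical all_reals all_analysis.
From mathcomp Require Import measurable_realfun ring lra zify.

Set Implicit Arguments.
Unset Strict Implicit.
Unset Printing Implicit Defensive.
Import Order.TTheory GRing.Theory Num.Theory.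
Import numFieldNormedType.Exports.

Local Open Scope ring_scope.

(** * Counting *)

(** The exponent of k comes from balancing two lengths. Cells of side 1/(4k) keep the mass of a cell
    below 1 + O(1/k), so that k groups of mass at least 1/2 can be formed. With k coordinates,
    layers along the walls that lose only a small fixed mass must be about k^2 times thinner than a
    cell, so of width of order 1/k^3. On a fixed grid so steep a cutoff would multiply a total
    energy of order k by the squared slope k^6. But only edges close to a wall pay, and averaging
    over about k^2 shifts divides the cost by k^2: this leaves k^5, rounded up to k^6 in
    [localization]. Lengths are rescaled so that the layer has width 1 and the walls are integers;
    averages over shifts become finite sums over residues modulo N.

    For an unbounded f the formula for K is meaningful only almost everywhere. Extension and
    localization therefore work with bounded functions, and the passage to L^2 is made on the
    quadratic form alone. Since clipping spoils exact orthonormality, the localization tolerates a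
    Gram matrix merely close to the identity. *)

Section counting.
Variable R : realType.
Implicit Types a b p q : R.

(** The summand 1 is the rounding error of counting lattice points. It is harmless in both uses: in
    [coarea] it is divided by the number of levels per unit, in [sum_near_walls] it enters a
    numerical constant. *)
Lemma count_between a b (B : nat) :
  \sum_(i < B) ((b <= i%:R) && (i%:R < a))%:R <= Num.max (a - b) 0 + 1.
Proof.
(* Stronger bound for the induction: it also records that the indices stop at [B] - 1. *)
have key : \sum_(i < B) ((b <= i%:R) && (i%:R < a))%:R <=
    Num.max 0 (Num.min a (B%:R - 1) - b + 1).
  elim: B => [|B IH]; first by rewrite big_ord0 le_max lexx.
  rewrite big_ord_recr/= -[B.+1]addn1 natrD; set S := \sum_(i < B) _ in IH *.
  case: andP => [[bB Ba]|_]; last first.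
    rewrite addr0; apply: le_trans IH _.
    rewrite ge_max !le_max lexx/=; apply/orP; right.
    by rewrite !lerD2r le_min !ge_min lexx/= addrK gerBl ler01 orbT.
  rewrite addrK (min_idPr (ltW Ba)).
  have aB : B%:R - 1 <= a by apply: le_trans (ltW Ba); rewrite gerBl.
  have SB : S <= B%:R - b.
    apply: le_trans IH _; rewrite (min_idPr aB) ge_max subr_ge0 bB/=; lra.
  by rewrite le_max; apply/orP; right; rewrite /=; lra.
apply: (le_trans key); rewrite /Order.max /Order.min.
by case: (ltP a (B%:R - 1)) => ?; do 2 case: ltP => ?; lra.
Qed.

(** For nonnegative [a] the count is the ceiling of [a], so no error term appears. *)
Lemma count_below a (B : nat) : a <= B%:R ->
  a <= \sum_(i < B) (i%:R < a)%R%:R.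
Proof.
elim: B a => [|B IH] a aB; first by rewrite big_ord0.
rewrite big_ord_recr/=; case: (ltP B%:R a) => Ba /=; last first.
  by rewrite addr0; exact: IH.
rewrite (eq_bigr (fun=> 1)) => [|i _].
  by rewrite sumr_const card_ord/= natr1.
by rewrite (lt_trans _ Ba)// ltr_nat.
Qed.

(** Euclidean division n = N c + j: a sum over all shifts j and all walls c becomes a sum over
    consecutive integers. *)
Lemma sum_euclid (N B : nat) (f : nat -> R) :
  \sum_(j < N) \sum_(c < B) f (N * c + j)%N = \sum_(n < N * B) f n.
Proof.
rewrite exchange_big/=; elim: B => [|B IH]; first by rewrite muln0 !big_ord0.
rewrite big_ord_recr/= IH mulnS addnC.
rewrite -(big_mkord xpredT f) -[in RHS](big_mkord xpredT f).
rewrite [RHS](@big_cat_nat _ _ _ (N * B))//= ?leq_addr//; congr (_ + _).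
rewrite -[X in index_iota X _]add0n big_addn addKn big_mkord.
by apply: eq_bigr => i _; rewrite addnC.
Qed.

(** Otherwise x_j / X + y_j / Y > 2 / N for every j, and the sum over j would exceed 2. One shift
    thus controls mass and energy at once. *)
Lemma pigeonhole_pair (N : nat) (x y : 'I_N -> R) (X Y : R) : (0 < N)%N ->
  (forall j, 0 <= x j) -> (forall j, 0 <= y j) -> 0 < X -> 0 < Y ->
  \sum_j x j <= X -> \sum_j y j <= Y ->
  exists j, x j <= 2 * X / N%:R /\ y j <= 2 * Y / N%:R.
Proof.
move=> N0 x0 y0 X0 Y0 xX yY; apply: contrapT => H.
have NR : 0 < N%:R :> R by rewrite ltr0n.
have big j : 2 / N%:R < x j / X + y j / Y.
  rewrite ltNge; apply/negP => le2; apply: H; exists j.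
  have xj : x j / X <= 2 / N%:R.
    by apply: le_trans le2; rewrite lerDl divr_ge0// ltW.
  have yj : y j / Y <= 2 / N%:R.
    by apply: le_trans le2; rewrite lerDr divr_ge0// ltW.
  by rewrite ler_pdivrMr// in xj; rewrite ler_pdivrMr// in yj; split; lra.
have : \sum_(j < N) (2 / N%:R) < \sum_(j < N) (x j / X + y j / Y) :> R.
  apply: ltr_sum => //; apply/hasP.
  by exists (Ordinal N0) => //; rewrite mem_index_enum.
rewrite sumr_const card_ord -[_ *+ N]mulr_natr divfK ?gt_eqF// big_split/=.
rewrite -!mulr_suml ltNge => /negP; apply.
by rewrite (_ : 2 = 1 + 1 :> R)// lerD// ler_pdivrMr// mul1r.
Qed.

(* An inclusion-minimal set of weight at least 1/2 is a singleton or has weight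
   at most 1. *)
Lemma min_half_set (T : finType) (w : T -> R) (e : R) (A : {set T}) :
  0 <= e -> (forall t, 0 <= w t <= 1 + e) -> 1 / 2 <= \sum_(t in A) w t ->
  exists G : {set T}, [/\ G \subset A, 1 / 2 <= \sum_(t in G) w t
    & \sum_(t in G) w t <= 1 + e].
Proof.
move=> e0 w1 hA.
have [G /minsetP[hG minG] GA] :=
  @minset_exists T (fun G => 1 / 2 <= \sum_(t in G) w t) A hA.
exists G; split=> //; have [->|[t tG]] := set_0Vmem G.
  by rewrite big_set0; lra.
rewrite (big_setD1 t)//=; have /andP[wt0 wt1] := w1 t.
have [G1|[t' t'G]] := set_0Vmem (G :\ t); first by rewrite G1 big_set0; lra.
have small s : s \in G -> \sum_(i in G :\ s) w i < 1 / 2.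
  move=> sG; rewrite ltNge; apply/negP => /minG /(_ (subD1set _ _)) GE.
  by move: sG; rewrite -GE !inE eqxx.
have := small _ tG; rewrite !inE in t'G; case/andP: t'G => t't t'G.
have := small _ t'G; rewrite (big_setD1 t)/= ?inE ?tG ?andbT 1?eq_sym//.
have : 0 <= \sum_(i in (G :\ t') :\ t) w i.
  by apply: sumr_ge0 => i _; case/andP: (w1 i).
lra.
Qed.

(** The threshold equals (k - 1)(1 + e) + 1/2: after k - 1 groups of weight at most 1 + e, a
    remainder of weight at least 1/2 is left for [min_half_set]. *)
Lemma greedy_groups (T : finType) (w : T -> R) (e : R) (k : nat) :
  0 <= e -> (forall t, 0 <= w t <= 1 + e) ->
  k%:R * (1 + e) - 1 / 2 - e <= \sum_t w t ->
  exists G : 'I_k -> {set T}, (forall l, 1 / 2 <= \sum_(t in G l) w t) /\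
    (forall l l', l != l' -> [disjoint G l & G l']).
Proof.
move=> e0 w1 tot.
suff H n : (n <= k)%N -> exists G : nat -> {set T},
    [/\ forall l, (l < n)%N -> 1 / 2 <= \sum_(t in G l) w t,
     forall l l', (l < l' < n)%N -> [disjoint G l & G l'] &
     \sum_(t in \bigcup_(l < n) G l) w t <= n%:R * (1 + e)].
  have [G [Gw Gd _]] := H k (leqnn k); exists (fun l => G l); split=> [l|l l' ll'].
    exact: Gw.
  have [lt|gt|/val_inj eq] := ltngtP l l'.
  - by apply: Gd; rewrite lt ltn_ord.
  - by rewrite disjoint_sym; apply: Gd; rewrite gt ltn_ord.
  - by rewrite eq eqxx in ll'.
elim: n => [_|n IH nk].
  by exists (fun=> finset.set0); split=> //; rewrite ?big_ord0 ?big_set0 ?mul0r// => l l' /andP[].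
have [G [Gw Gd Gt]] := IH (ltnW nk).
set U := (\bigcup_(l < n) G l)%SET in Gt.
have [|G' [G'U G'w G'1]] := @min_half_set T w e (~: U) e0 w1.
  have : \sum_t w t = \sum_(t in U) w t + \sum_(t in ~: U) w t.
    by rewrite (bigID (mem U))/=; congr (_ + _); apply: eq_bigl => t; rewrite inE.
  have : (n%:R + 1) * (1 + e) <= k%:R * (1 + e).
    by rewrite ler_wpM2r ?addr_ge0// natr1 ler_nat.
  lra.
pose G2 l := if l == n then G' else G l.
have G2E : (\bigcup_(l < n.+1) G2 l = U :|: G')%SET.
  rewrite big_ord_recr/= /G2 eqxx; congr (_ :|: _)%SET.
  by apply: eq_bigr => i _; rewrite ltn_eqF.
have UG' : [disjoint U & G'] by rewrite disjoint_sym finset.disjoints_subset.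
exists G2; split=> [l|l l' /andP[ll' l'n]|].
- by rewrite ltnS leq_eqVlt /G2 => /orP[/eqP->|ln]; [rewrite eqxx|rewrite ltn_eqF// Gw].
- rewrite /G2; case: (eqVneq l' n) => [l'E|l'n'].
    rewrite -l'E ltn_eqF//; apply: disjointWl UG'.
    have ln : (l < n)%N by rewrite -l'E.
    exact: (finset.bigcup_sup (Ordinal ln)).
  have l'n2 : (l' < n)%N by rewrite ltn_neqAle l'n' -ltnS.
  by rewrite ltn_eqF ?(ltn_trans ll')//; apply: Gd; rewrite ll'.
- rewrite G2E; under eq_bigl do rewrite finset.in_setU.
  rewrite bigU//= -natr1 mulrDl mul1r.
  exact: lerD.
Qed.

End counting.

(** * Shifted walls on the line and the average cost of being near one *)

Section walls.
Variables (R : realType) (N B : nat).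
Implicit Types p q : R.

(* The walls are the points N c + j, c < B. *)
Definition near_walls (j : nat) p q : R :=
  \sum_(c < B) ((Num.min p q - 1 < (N * c + j)%:R) &&
                ((N * c + j)%:R < Num.max p q + 1))%:R.

Lemma near_walls_ge0 j p q : 0 <= near_walls j p q.
Proof. by apply: sumr_ge0 => c _; rewrite ler0n. Qed.

Lemma near_walls_ge1 j p q (c : 'I_B) :
  Num.min p q - 1 < (N * c + j)%:R -> (N * c + j)%:R < Num.max p q + 1 ->
  1 <= near_walls j p q.
Proof.
move=> h1 h2; rewrite /near_walls (bigD1 c)//= h1 h2 lerDl.
by apply: sumr_ge0 => i _; rewrite ler0n.
Qed.

(** Each integer below N B is a wall of exactly one shift, so the sum over shifts counts integers in
    an interval of length |p - q| + 2. *)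
Lemma sum_near_walls p q :
  \sum_(j < N) near_walls j p q <= `|p - q| + 3.
Proof.
rewrite /near_walls (sum_euclid N B (fun n => ((Num.min p q - 1 < n%:R) &&
   (n%:R < Num.max p q + 1))%:R : R)).
apply: (@le_trans _ _ (\sum_(i < N * B) ((Num.min p q - 1 <= i%:R) &&
    (i%:R < Num.max p q + 1))%:R)).
  by apply: ler_sum => i _; rewrite ler_nat; case: ltP => // /ltW ->.
apply: le_trans (count_between _ _ _) _.
have E : Num.max p q - Num.min p q = `|p - q|.
  by case: leP => [?|/ltW ?]; [rewrite ler0_norm|rewrite ger0_norm];
    rewrite ?opprB ?subr_le0 ?subr_ge0.
have D0 := normr_ge0 (p - q).
have : Num.max (Num.max p q + 1 - (Num.min p q - 1)) 0 <= `|p - q| + 2.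
  by rewrite ge_max; apply/andP; split; lra.
lra.
Qed.

(** This is the gain from averaging. Along an edge from [p] to [q] a cutoff moves by at most min(1,
    |p - q|), and only if a wall is near; the squared cost summed over all [N] shifts is O(|p -
    q|^2), so a typical shift pays it with the factor 1/N. For long edges the cap 1 suffices, since
    D + 3 <= 4 D^2 once D >= 1. *)
Lemma sum_wall_cost p q :
  \sum_(j < N) Num.min 1 ((p - q) ^+ 2) * near_walls j p q <= 4 * (p - q) ^+ 2.
Proof.
rewrite -mulr_sumr; apply: (@le_trans _ _ (Num.min 1 ((p - q) ^+ 2) * (`|p - q| + 3))).
  by rewrite ler_wpM2l ?sum_near_walls// le_min ler01 sqr_ge0.
rewrite -(real_normK (num_real (p - q))); set D : R := `|p - q|.
have D0 : 0 <= D by exact: normr_ge0.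
case: (leP 1 (D ^+ 2)) => [D1|/ltW D1]; last first.
  have : D <= 1 by rewrite -(expr_le1 (ltn0Sn 1) D0).
  by move=> ?; rewrite mulrC ler_wpM2r ?sqr_ge0//; lra.
have : 1 <= D by rewrite -(expr_ge1 (ltn0Sn 1) D0).
by move=> ?; rewrite mul1r; nra.
Qed.

(** Walls are [N] apart and the lowest one is at [j] < [N], so the first wall above [p] is within
    [N] of [p] and would separate it from any [q] further up. The bound by [B] ensures that this
    wall is among those listed. *)
Lemma same_cell_diam (j : nat) p q : (j < N)%N -> 0 <= p -> 0 <= q ->
  p < B%:R -> q < B%:R ->
  (forall c : 'I_B, ((N * c + j)%:R <= p) = ((N * c + j)%:R <= q)) ->
  `|p - q| <= N%:R.
Proof.
wlog pq : p q / p <= q => [H|].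
  move=> jN p0 q0 pB qB H'; have [pq|/ltW pq] := leP p q; first exact: H.
  by rewrite distrC; apply: H => // c; rewrite H'.
move=> jN p0 q0 pB qB H; rewrite ler0_norm ?subr_le0// opprB leNgt; apply/negP => qpN.
have N0 : (0 < N)%N by exact: leq_ltn_trans jN.
have ex : exists c, p < (N * c + j)%:R.
  exists B; apply: lt_le_trans pB _; rewrite ler_nat.
  by rewrite (leq_trans (leq_pmull B N0))// leq_addr.
pose c := ex_minn ex; have [pc minc] : p < (N * c + j)%:R /\
    forall n, p < (N * n + j)%:R -> (c <= n)%N by rewrite /c; case: ex_minnP.
have cq : (N * c + j)%:R <= q.
  case: c pc minc => [|c] pc minc.
    rewrite muln0 add0n; have : j%:R <= N%:R :> R by rewrite ler_nat ltnW.
    lra.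
  have : (N * c + j)%:R <= p.
    by rewrite leNgt; apply/negP => /minc; rewrite ltnn.
  by rewrite mulnS -addnA natrD; lra.
have cB : (c < B)%N.
  rewrite -(ltr_nat R); apply: le_lt_trans qB; apply: le_trans cq.
  by rewrite ler_nat (leq_trans (leq_pmull c N0))// leq_addr.
by have := H (Ordinal cB); rewrite /= cq leNgt pc.
Qed.

End walls.

(** * Radial projection and cutoff functions *)

Section euclidean.
Variables (R : realType) (k : nat).
Implicit Types p q : 'I_k -> R.

Definition nrm p : R := Num.sqrt (\sum_i p i ^+ 2).
(** At the origin division by zero gives the zero vector, which lets [nrm_dir] hold without
    exception. *)
Definition dir p : 'I_k -> R := fun i => p i / nrm p.

Lemma nrm_ge0 p : 0 <= nrm p. Proof. exact: sqrtr_ge0. Qed.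

Lemma nrm_sqr p : nrm p ^+ 2 = \sum_i p i ^+ 2.
Proof. by rewrite sqr_sqrtr// sumr_ge0// => i _; exact: sqr_ge0. Qed.

Lemma nrm0 p : nrm p = 0 -> forall i, p i = 0.
Proof.
move=> p0 i; have := nrm_sqr p; rewrite p0 expr0n/= => /esym/eqP.
rewrite psumr_eq0 => [/allP/(_ i)|j _]; last exact: sqr_ge0.
by rewrite mem_index_enum sqrf_eq0 => /(_ isT)/eqP.
Qed.

Lemma nrm_dir p i : nrm p * dir p i = p i.
Proof.
rewrite /dir; have [p0|p0] := eqVneq (nrm p) 0; first by rewrite p0 mul0r nrm0.
by rewrite mulrC divfK.
Qed.

Lemma dir_sqr p : nrm p != 0 -> \sum_i dir p i ^+ 2 = 1.
Proof.
move=> p0; under eq_bigr do rewrite exprMn.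
by rewrite -mulr_suml -nrm_sqr -exprMn divff// expr1n.
Qed.

Lemma dir_le1 p i : `|dir p i| <= 1.
Proof.
have [p0|p0] := eqVneq (nrm p) 0; first by rewrite /dir p0 invr0 mulr0 normr0.
rewrite -(expr_le1 (ltn0Sn 1))// real_normK ?num_real// -(dir_sqr p0).
rewrite (bigD1 i)//= lerDl sumr_ge0// => j _; exact: sqr_ge0.
Qed.

Lemma sum_sqrB p q : \sum_i (p i - q i) ^+ 2 =
  \sum_i p i ^+ 2 - 2 * (\sum_i p i * q i) + \sum_i q i ^+ 2.
Proof.
rewrite mulr_sumr -sumrB -big_split/=; apply: eq_bigr => i _; ring.
Qed.

Lemma dot_dir_le1 p q : nrm p != 0 -> nrm q != 0 -> `|\sum_i dir p i * dir q i| <= 1.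
Proof.
move=> p0 q0; have := sum_sqrB (dir p) (dir q).
have : \sum_i (dir p i + dir q i) ^+ 2 =
    \sum_i dir p i ^+ 2 + 2 * (\sum_i dir p i * dir q i) + \sum_i dir q i ^+ 2.
  by rewrite mulr_sumr -!big_split/=; apply: eq_bigr => i _; ring.
have h1 : 0 <= \sum_i (dir p i - dir q i) ^+ 2.
  by apply: sumr_ge0 => i _; exact: sqr_ge0.
have h2 : 0 <= \sum_i (dir p i + dir q i) ^+ 2.
  by apply: sumr_ge0 => i _; exact: sqr_ge0.
rewrite !dir_sqr// => e1 e2; rewrite ler_norml; apply/andP; split; lra.
Qed.

Lemma dot_dir p q : \sum_i p i * q i = nrm p * nrm q * \sum_i dir p i * dir q i.
Proof.
rewrite mulr_sumr; apply: eq_bigr => i _.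
by rewrite -[in LHS](nrm_dir p) -[in LHS](nrm_dir q); ring.
Qed.

Lemma nrmB_le p q : (nrm p - nrm q) ^+ 2 <= \sum_i (p i - q i) ^+ 2.
Proof.
rewrite sum_sqrB -!nrm_sqr dot_dir.
have P0 := nrm_ge0 p; have Q0 := nrm_ge0 q.
have [p0|p0] := eqVneq (nrm p) 0; first by rewrite p0; lra.
have [q0|q0] := eqVneq (nrm q) 0; first by rewrite q0; lra.
have := dot_dir_le1 p0 q0; set t := \sum_i _; rewrite ler_norml => /andP[_ t1].
have : nrm p * nrm q * t <= nrm p * nrm q * 1 by rewrite ler_wpM2l ?mulr_ge0.
lra.
Qed.

(** Radial projection has slope of order 1/|q| near q. Only the norm of one endpoint appears, as in
    the splitting of edge differences made in [localization]. *)
Lemma dirB_le p q :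
  nrm q ^+ 2 * \sum_i (dir p i - dir q i) ^+ 2 <= 4 * \sum_i (p i - q i) ^+ 2.
Proof.
have P0 := nrm_ge0 p; have Q0 := nrm_ge0 q.
have [q0|q0] := eqVneq (nrm q) 0.
  by rewrite q0 expr0n mul0r mulr_ge0// sumr_ge0// => i _; exact: sqr_ge0.
have [p0|p0] := eqVneq (nrm p) 0.
  have pi0 := nrm0 p0; rewrite mulr_sumr mulr_sumr; apply: ler_sum => i _.
  rewrite /dir pi0 mul0r !sub0r !sqrrN -exprMn mulrC divfK//.
  have := sqr_ge0 (q i); lra.
rewrite !sum_sqrB !dir_sqr// (dot_dir p q) -!nrm_sqr.
have := dot_dir_le1 p0 q0; set t := \sum_i _; rewrite ler_norml => /andP[t1 t2].
set P := nrm p in P0 *; set Q := nrm q in Q0 *.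
have h : 0 <= Q ^+ 2 * (1 + t) * (1 - t).
  by rewrite !mulr_ge0 ?sqr_ge0//; lra.
have h2 : P * Q * t <= P * Q * 1 by rewrite ler_wpM2l ?mulr_ge0.
have h3 := sqr_ge0 (2 * P - Q * (1 + t)).
(* With t the cosine of the angle, the gap is a square plus nonnegative multiples of 1 - t^2 and of
   1 - t. *)
rewrite -subr_ge0 (_ : _ - _ = (2 * P - Q * (1 + t)) ^+ 2 +
  Q ^+ 2 * (1 + t) * (1 - t) + 4 * (P * Q * 1 - P * Q * t)); last by ring.
by rewrite !addr_ge0// mulr_ge0// subr_ge0.
Qed.

End euclidean.

Section cutoff.
Variables (R : realType) (k N B : nat) (j : 'I_k -> 'I_N).
Implicit Types U W : 'I_k -> R.

Definition wall (p : 'I_k * 'I_B) : R := (N * p.2 + j p.1)%:R.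

Definition cutoff U : R := \big[Num.min/1]_(p : 'I_k * 'I_B) `|U p.1 - wall p|.

(** A cell is encoded by the side of each wall on which the point lies. The codes form a finite
    type, as the greedy grouping requires; some of them may be empty cells. *)
Definition cell U : {ffun 'I_k * 'I_B -> bool} := [ffun p => wall p <= U p.1].

Lemma cutoff_ge0 U : 0 <= cutoff U.
Proof. by apply/bigmin_geP; split. Qed.

Lemma cutoff_le1 U : cutoff U <= 1.
Proof. exact: bigmin_le_id. Qed.

Lemma cutoff_le U p : cutoff U <= `|U p.1 - wall p|.
Proof. exact: bigmin_le_cond. Qed.

Lemma cutoff_lt1 U : cutoff U < 1 -> exists p, cutoff U = `|U p.1 - wall p|.
Proof.
rewrite /cutoff; elim/big_ind: _ => [|x y Hx Hy|p _ _]; first by rewrite ltxx.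
  by case: (leP x y) => _; [exact: Hx|exact: Hy].
by exists p.
Qed.


Lemma cutoff_near U : (cutoff U != 1)%:R <= \sum_i near_walls N B (j i) (U i) (U i) :> R.
Proof.
have S0 i : 0 <= near_walls N B (j i) (U i) (U i) by exact: near_walls_ge0.
case: eqVneq => [|c1]; first by rewrite sumr_ge0.
have /cutoff_lt1[p pE] : cutoff U < 1 by rewrite lt_neqAle c1 cutoff_le1.
rewrite (bigD1 p.1)//= -[leLHS]addr0 lerD ?sumr_ge0//.
have : `|U p.1 - wall p| < 1 by rewrite -pE lt_neqAle c1 cutoff_le1.
rewrite ltr_norml => /andP[h1 h2].
by apply: (near_walls_ge1 (c := p.2)); rewrite minxx || rewrite maxxx;
  rewrite -/(wall p); lra.
Qed.

(** A single coordinate already dominates the left side: a change of value forces a wall of that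
    coordinate to be within 1 of the segment from [U] to [W]. *)
Lemma cutoff_cell_diff (G : {set {ffun 'I_k * 'I_B -> bool}}) U W :
  (cutoff U * (cell U \in G)%:R - cutoff W * (cell W \in G)%:R) ^+ 2 <=
  \sum_i Num.min 1 ((U i - W i) ^+ 2) * near_walls N B (j i) (U i) (W i).
Proof.
set D := _ - _.
have key : D = 0 \/ exists i, D ^+ 2 <= Num.min 1 ((U i - W i) ^+ 2) /\
    1 <= near_walls N B (j i) (U i) (W i).
  have cU := cutoff_le1 U; have cW := cutoff_le1 W.
  have cU0 := cutoff_ge0 U; have cW0 := cutoff_ge0 W.
  (* In a common cell only the cutoff varies. If the values differ, the smaller one is below 1,
     hence is the distance to some wall, and the distance to that wall is 1-Lipschitz. *)
  have [cellE|/eqP] := eqVneq (cell U) (cell W).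
    suff H : cutoff U = cutoff W \/ exists i,
      `|cutoff U - cutoff W| <= `|U i - W i| /\ 1 <= near_walls N B (j i) (U i) (W i).
      case: H => [E|[i [Hi Hn]]]; first by left; rewrite /D cellE E subrr.
      right; exists i; split=> //.
      rewrite /D cellE -mulrBl exprMn le_min -[X in _ && (_ <= X)]real_normK ?num_real//.
      rewrite -(real_normK (num_real (cutoff U - _))).
      have b1 : `|cutoff U - cutoff W| <= 1 by rewrite ler_norml; apply/andP; split; lra.
      case: (_ \in _); rewrite ?expr1n ?mulr1 ?expr0n/= ?mulr0 ?ler01 ?sqr_ge0//.
      by rewrite expr_le1// b1/= ler_pXn2r ?nnegrE.
    wlog UW : U W cellE {cU cW cU0 cW0 D} / cutoff U < cutoff W.
      move=> H; have [lt|gt|->] := ltgtP (cutoff U) (cutoff W); last by left.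
        exact: H.
      have [->|[i [h1 h2]]] := H W U (esym cellE) gt; first by left.
      right; exists i; rewrite distrC [`|U i - _|]distrC; split=> //.
      by rewrite /near_walls minC maxC.
    right; have [p pE] := cutoff_lt1 (lt_le_trans UW (cutoff_le1 W)).
    exists p.1; have Wp := cutoff_le W p.
    have U1 : `|U p.1 - wall p| < 1 by rewrite -pE (lt_le_trans UW)// cutoff_le1.
    split.
      rewrite ltr0_norm ?subr_lt0// opprB pE.
      rewrite lerBlDr; apply: le_trans Wp _; rewrite [`|U p.1 - W p.1|]distrC.
      apply: le_trans (ler_normD _ _); rewrite le_eqVlt; apply/orP; left.
      by apply/eqP; congr `|_|; ring.
    move: U1; rewrite ltr_norml => /andP[h1 h2].
    apply: (near_walls_ge1 (c := p.2)); rewrite -/(wall p).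
      by rewrite ltrBlDr gt_min; apply/orP; left; lra.
    by rewrite -ltrBlDr lt_max; apply/orP; left; lra.
  (* Across cells some wall separates the two points in its coordinate. Both cutoffs are at most the
     distance to it, which is at most the separation, whatever the membership in [G]. *)
  move=> /ffunP cellN; right.
  have [p] : exists p, cell U p != cell W p.
    apply: contrapT => H; apply: cellN => p; apply/eqP/negP => /negP H'.
    by apply: H; exists p.
  rewrite !ffunE => Hp; exists p.1.
  have [Up Wp] := (cutoff_le U p, cutoff_le W p).
  have [dU dW] : `|U p.1 - wall p| <= `|U p.1 - W p.1| /\
      `|W p.1 - wall p| <= `|U p.1 - W p.1|.
    move: Hp; case: (leP (wall p) (U p.1)) => h1; case: (leP (wall p) (W p.1)) => h2 // _.
      by rewrite (ger0_norm (x := U p.1 - _)) ?(ltr0_norm (x := W p.1 - _)) ?ger0_norm; lra.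
    by rewrite (ltr0_norm (x := U p.1 - _)) ?(ger0_norm (x := W p.1 - _)) ?ltr0_norm; lra.
  split.
    have bD : `|D| <= Num.min 1 `|U p.1 - W p.1|.
      have cU' := le_trans Up dU; have cW' := le_trans Wp dW.
      rewrite /D le_min; move: cU' cW'; set e := `|U p.1 - _| => cU' cW'.
      have e0 : 0 <= e := normr_ge0 _.
      by apply/andP; split; rewrite ler_norml; do 2 case: (_ \in _);
        rewrite /= ?mulr1 ?mulr0; apply/andP; split; lra.
    move: bD; rewrite !le_min => /andP[h1 h2].
    rewrite -(real_normK (num_real D)) -(real_normK (num_real (U p.1 - _))).
    by rewrite expr_le1// h1/= ler_pXn2r ?nnegrE.
  apply: (near_walls_ge1 (c := p.2)); rewrite -/(wall p).
    rewrite ltrBlDr gt_min; apply/orP; move: Hp.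
    by case: (leP (wall p) (U p.1)) => h1; case: (leP (wall p) (W p.1)) => h2 // _;
      [right|left]; lra.
  rewrite -ltrBlDr lt_max; apply/orP; move: Hp.
  by case: (leP (wall p) (U p.1)) => h1; case: (leP (wall p) (W p.1)) => h2 // _;
    [left|right]; lra.
have S0 i : 0 <= Num.min 1 ((U i - W i) ^+ 2) * near_walls N B (j i) (U i) (W i).
  by rewrite mulr_ge0 ?near_walls_ge0// le_min ler01 sqr_ge0.
case: key => [->|[i [h1 h2]]]; first by rewrite expr0n/= sumr_ge0.
rewrite (bigD1 i)//= -[leLHS]addr0 lerD ?sumr_ge0//.
by apply: le_trans h1 _; rewrite ler_peMr// le_min ler01 sqr_ge0.
Qed.

Lemma cell_diam U W i : (forall i, 0 <= U i < B%:R) -> (forall i, 0 <= W i < B%:R) ->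
  cell U = cell W -> `|U i - W i| <= N%:R.
Proof.
move=> /(_ i)/andP[U0 UB] /(_ i)/andP[W0 WB] /ffunP cE.
apply: (same_cell_diam (ltn_ord (j i)) U0 W0 UB WB) => c.
by have := cE (i, c); rewrite !ffunE.
Qed.

End cutoff.

(** * Orthonormal families for a positive definite matrix *)

Section orthonormalization.
Variables (R : rcfType) (k : nat) (G : 'M[R]_k).
Hypothesis Gsym : G^T = G.
Hypothesis Gpos : forall v : 'rV[R]_k, v != 0 -> 0 < (v *m G *m v^T) 0 0.

(* A vector G-orthogonal to m < k given ones exists by a rank count. *)
Lemma orthonormal_family (m : nat) : (m <= k)%N ->
  exists C : 'M[R]_(m, k), C *m G *m C^T = 1%:M.
Proof.
elim: m => [_|m IH mk]; first by exists 0; apply/matrixP => -[].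
have [C CG] := IH (ltnW mk).
have /rowV0Pn[v /sub_kermxP vA v0] : kermx (G *m C^T) != 0.
  rewrite -mxrank_eq0 mxrank_ker -lt0n subn_gt0.
  by apply: leq_ltn_trans (rank_leq_col _) mk.
set q := (v *m G *m v^T) 0 0; have q0 : 0 < q by exact: Gpos.
pose w := (Num.sqrt q)^-1 *: v.
have wC : w *m G *m C^T = 0.
  by rewrite -scalemxAl -scalemxAl -mulmxA vA scaler0.
have Cw : C *m G *m w^T = 0.
  by apply: trmx_inj; rewrite trmx0 !trmx_mul trmxK Gsym mulmxA.
have ww : w *m G *m w^T = 1%:M.
  rewrite [LHS]mx11_scalar; congr (_%:M).
  rewrite linearZ/= -scalemxAl -scalemxAl -scalemxAr scalerA mxE -/q.
  by rewrite -expr2 exprVn sqr_sqrtr ?ltW// mulVf ?gt_eqF.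
rewrite -addn1; exists (col_mx C w).
rewrite mul_col_mx tr_col_mx mul_col_row wC Cw ww CG.
by rewrite -scalar_mx_block.
Qed.

End orthonormalization.

Local Open Scope classical_set_scope.

(** * Bounded measurable functions and the edge integral *)

Section bounded_measurable.
Context d (T : measurableType d) (R : realType).
Implicit Types f g : T -> R.

(** Such functions are integrable for every finite measure and stable under all operations used, so
    integrals split freely. The bound is uniform, hence survives integration against each [P x]. *)
Definition bmeas f := measurable_fun [set: T] f /\ exists C, forall x, `|f x| <= C.

Lemma bmeas_measurable f : bmeas f -> measurable_fun [set: T] f.
Proof. by case. Qed.

Lemma bmeas_cst (c : R) : bmeas (fun=> c).
Proof. by split; [exact: measurable_cst|exists `|c|]. Qed.

Lemma bmeasD f g : bmeas f -> bmeas g -> bmeas (fun x => f x + g x).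
Proof.
move=> [mf [C fC]] [mg [D gD]]; split; first exact: measurable_funD.
by exists (C + D) => x; apply: le_trans (ler_normD _ _) _; exact: lerD.
Qed.

Lemma bmeasM f g : bmeas f -> bmeas g -> bmeas (fun x => f x * g x).
Proof.
move=> [mf [C fC]] [mg [D gD]]; split; first exact: measurable_funM.
by exists (C * D) => x; rewrite normrM ler_pM.
Qed.

Lemma bmeasN f : bmeas f -> bmeas (fun x => - f x).
Proof.
move=> [mf [C fC]]; split; first exact: measurableT_comp.
by exists C => x; rewrite normrN.
Qed.

Lemma bmeasB f g : bmeas f -> bmeas g -> bmeas (fun x => f x - g x).
Proof. by move=> bf bg; apply: bmeasD => //; exact: bmeasN. Qed.

Lemma bmeasX f n : bmeas f -> bmeas (fun x => f x ^+ n).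
Proof.
move=> bf; elim: n => [|n IH]; first exact: bmeas_cst.
by under eq_fun do rewrite exprS; exact: bmeasM.
Qed.

Lemma bmeas_sum (I : Type) (s : seq I) (p : pred I) (F : I -> T -> R) :
  (forall i, bmeas (F i)) -> bmeas (fun x => \sum_(i <- s | p i) F i x).
Proof.
move=> bF; elim: s => [|i s IH].
  by under eq_fun do rewrite big_nil; exact: bmeas_cst.
under eq_fun do rewrite big_cons; case: (p i) => //; exact: bmeasD.
Qed.

Lemma bmeas_bool (b : T -> bool) : measurable_fun [set: T] b ->
  bmeas (fun x => (b x)%:R).
Proof.
move=> mb; split.
  apply: (@measurableT_comp _ _ _ _ _ _ (fun c : bool => c%:R : R)) => //.
by exists 1 => x; case: (b x); rewrite ?normr1 ?normr0.
Qed.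

Lemma bmeas_indic (A : set T) : measurable A -> bmeas (\1_A : T -> R).
Proof.
move=> mA; split; first exact: measurable_indic.
by exists 1 => x; rewrite indicE; case: (x \in A); rewrite ?normr1 ?normr0.
Qed.

Lemma bmeas_normr f : bmeas f -> bmeas (fun x => `|f x|).
Proof.
move=> [mf [C fC]]; split; first exact: measurableT_comp.
by exists C => x; rewrite normr_id.
Qed.

Lemma bmeas_min f g : bmeas f -> bmeas g -> bmeas (fun x => Num.min (f x) (g x)).
Proof.
move=> [mf [C fC]] [mg [D gD]]; split; first exact: measurable_minr.
exists (Num.max C D) => x; by rewrite le_max; case: (leP (f x) (g x)) => _; rewrite ?fC ?gD ?orbT.
Qed.

Lemma bmeas_dominated f g : measurable_fun [set: T] f -> bmeas g ->
  (forall x, `|f x| <= g x) -> bmeas f.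
Proof.
move=> mf [_ [C gC]] fg; split=> //; exists C => x.
by apply: le_trans (fg x) _; apply: le_trans (ler_norm _) (gC x).
Qed.

Section integral.
Variable m : {measure set T -> \bar R}.
Hypothesis mfin : (m [set: T] < +oo)%E.

Lemma bmeas_integrable f : bmeas f -> m.-integrable [set: T] (EFin \o f).
Proof.
move=> [mf [C fC]]; apply: measurable_bounded_integrable => //.
by exists C; split=> [|D CD y _]; [exact: num_real|exact: le_trans (fC y) (ltW CD)].
Qed.

Lemma RintD f g : bmeas f -> bmeas g ->
  \int[m]_x (f x + g x) = \int[m]_x f x + \int[m]_x g x.
Proof. by move=> bf bg; rewrite RintegralD//; exact: bmeas_integrable. Qed.

Lemma RintB f g : bmeas f -> bmeas g ->
  \int[m]_x (f x - g x) = \int[m]_x f x - \int[m]_x g x.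
Proof. by move=> bf bg; rewrite RintegralB//; exact: bmeas_integrable. Qed.

Lemma RintZ (c : R) f : bmeas f -> \int[m]_x (c * f x) = c * \int[m]_x f x.
Proof. by move=> bf; rewrite RintegralZl//; exact: bmeas_integrable. Qed.

Lemma le_Rint f g : bmeas f -> bmeas g -> (forall x, f x <= g x) ->
  \int[m]_x f x <= \int[m]_x g x.
Proof.
by move=> bf bg fg; apply: le_Rintegral => //; exact: bmeas_integrable.
Qed.

Lemma Rint_sum (I : Type) (s : seq I) (p : pred I) (F : I -> T -> R) :
  (forall i, bmeas (F i)) ->
  \int[m]_x (\sum_(i <- s | p i) F i x) = \sum_(i <- s | p i) \int[m]_x F i x.
Proof.
move=> bF; elim: s => [|i s IH].
  under eq_Rintegral do rewrite big_nil.
  by rewrite big_nil Rintegral_cst// mul0r.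
under eq_Rintegral do rewrite big_cons.
rewrite big_cons; case: (p i) => //; rewrite RintD ?IH//; exact: bmeas_sum.
Qed.

Lemma Rint_indic A : measurable A -> \int[m]_x (\1_A x : R) = fine (m A).
Proof. by move=> mA; rewrite /Rintegral integral_indic// setIT. Qed.

Lemma EFin_Rint f : bmeas f -> (forall x, 0 <= f x) ->
  (\int[m]_x f x)%R%:E = (\int[m]_x (f x)%:E)%E.
Proof.
move=> bf f0; rewrite /Rintegral fineK//; apply: integrable_fin_num => //.
exact: bmeas_integrable.
Qed.

End integral.
End bounded_measurable.

Lemma bmeas_comp d d' (S : measurableType d) (T : measurableType d') (R : realType)
    (f : T -> R) (h : S -> T) :
  measurable_fun [set: S] h -> bmeas f -> bmeas (fun x => f (h x)).
Proof.
move=> mh [mf [C fC]]; split; first exact: measurableT_comp.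
by exists C => x.
Qed.

Section kernel_integral.
Context d (M : measurableType d) (R : realType).
Variables (mu : probability M R) (P : R.-pker M ~> M).
Implicit Types (f g : M -> R) (G H : M * M -> R).

Lemma pker_fin x : (P x [set: M] < +oo)%E.
Proof. by rewrite (@prob_kernel _ _ _ _ _ P x) ltry. Qed.

Lemma prob_fin : (mu [set: M] < +oo)%E.
Proof. by rewrite probability_setT ltry. Qed.

Lemma bmeas_slice G x : bmeas G -> bmeas (fun y => G (x, y)).
Proof. by move=> bG; apply: (bmeas_comp _ bG); exact: measurable_pair1. Qed.

Lemma measurable_kernel_Rint G : bmeas G ->
  measurable_fun [set: M] (fun x => \int[P x]_y G (x, y)).
Proof.
move=> bG; have [_ [C GC]] := bG.
have C0 z : 0 <= G z + C.
  by have := GC z; rewrite ler_norml => /andP[]; rewrite -lerBlDr sub0r.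
(* Adding the bound [C] makes the integrand nonnegative; the constant is then subtracted, each [P x]
   having mass 1. *)
rewrite (_ : (fun x => _) =
    (fun x => fine (\int[P x]_y (G (x, y) + C)%:E)%E - C)); last first.
  apply/funext => x; rewrite -/(Rintegral _ _ _) (@RintD _ _ _ _ (pker_fin x)).
  - rewrite Rintegral_cst// (@prob_kernel _ _ _ _ _ P x) mulr1; ring.
  - exact: bmeas_slice.
  - exact: bmeas_cst.
apply: measurable_funB => //; apply: measurableT_comp => //.
apply: (measurable_fun_integral_finite_kernel (fun z => (G z + C)%:E) P).
  by move=> z; rewrite lee_fin.
by apply/measurable_EFinP; apply: measurable_funD => //; case: bG.
Qed.

Lemma bmeas_kernel_Rint G : bmeas G -> bmeas (fun x => \int[P x]_y G (x, y)).
Proof.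
move=> bG; split; first exact: measurable_kernel_Rint.
have [_ [C GC]] := bG; exists C => x.
apply: le_trans (le_normr_Rintegral _ _) _ => //.
  by apply: bmeas_integrable (bmeas_slice x bG); exact: pker_fin.
apply: (@le_trans _ _ (\int[P x]_y C)).
  apply: le_Rint => //; first exact: pker_fin.
  - exact/bmeas_normr/bmeas_slice.
  - exact: bmeas_cst.
by rewrite Rintegral_cst// (@prob_kernel _ _ _ _ _ P x) mulr1.
Qed.

Definition edge_int G : R := \int[mu]_x \int[P x]_y G (x, y).

Lemma edge_intD G H : bmeas G -> bmeas H ->
  edge_int (fun z => G z + H z) = edge_int G + edge_int H.
Proof.
move=> bG bH; rewrite /edge_int -(RintD prob_fin); try exact: bmeas_kernel_Rint.
apply: eq_Rintegral => x _; rewrite (RintD (pker_fin x)) //; exact: bmeas_slice.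
Qed.

Lemma edge_intZ (c : R) G : bmeas G ->
  edge_int (fun z => c * G z) = c * edge_int G.
Proof.
move=> bG; rewrite /edge_int -(RintZ prob_fin); last exact: bmeas_kernel_Rint.
apply: eq_Rintegral => x _; rewrite (RintZ (pker_fin x)) //; exact: bmeas_slice.
Qed.

Lemma edge_intB G H : bmeas G -> bmeas H ->
  edge_int (fun z => G z - H z) = edge_int G - edge_int H.
Proof.
move=> bG bH; rewrite edge_intD//; last exact: bmeasN.
congr (_ + _); under [in LHS]eq_fun do rewrite -mulN1r.
by rewrite edge_intZ// mulN1r.
Qed.

Lemma le_edge_int G H : bmeas G -> bmeas H -> (forall z, G z <= H z) ->
  edge_int G <= edge_int H.
Proof.
move=> bG bH GH; apply: (le_Rint prob_fin); [exact: bmeas_kernel_Rint..|].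
by move=> x; apply: (le_Rint (pker_fin x)) => // ; exact: bmeas_slice.
Qed.

Lemma edge_int_ge0 G : (forall z, 0 <= G z) -> 0 <= edge_int G.
Proof. by move=> G0; apply: Rintegral_ge0 => x _; apply: Rintegral_ge0. Qed.

Lemma edge_int_sum (I : Type) (s : seq I) (p : pred I) (F : I -> M * M -> R) :
  (forall i, bmeas (F i)) ->
  edge_int (fun z => \sum_(i <- s | p i) F i z) = \sum_(i <- s | p i) edge_int (F i).
Proof.
move=> bF; rewrite /edge_int -(Rint_sum prob_fin) => [|i]; last exact: bmeas_kernel_Rint.
apply: eq_Rintegral => x _; rewrite (Rint_sum (pker_fin x))// => i.
exact: bmeas_slice.
Qed.

Lemma edge_int_fst f : bmeas f -> edge_int (fun z => f z.1) = \int[mu]_x f x.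
Proof.
move=> bf; apply: eq_Rintegral => x _; rewrite /= Rintegral_cst//.
by rewrite (@prob_kernel _ _ _ _ _ P x) mulr1.
Qed.

Lemma edge_int_cst (c : R) : edge_int (fun=> c) = c.
Proof.
rewrite (@edge_int_fst (fun=> c)); last exact: bmeas_cst.
rewrite Rintegral_cst// -[RHS]mulr1; congr (c * _).
exact: (congr1 fine (probability_setT mu)).
Qed.

Lemma edge_int_boundary (A : set M) : measurable A ->
  (edge_int (fun z => \1_A z.1 * \1_(~` A) z.2))%:E =
  edge_measure mu P (edge_boundary A).
Proof.
move=> mA.
have bE : bmeas (fun z : M * M => \1_A z.1 * \1_(~` A) z.2 : R).
  apply: bmeasM; apply: bmeas_comp; try exact: measurable_fst; try exact: measurable_snd.
    exact: bmeas_indic.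
  by apply: bmeas_indic; exact: measurableC.
have E0 z : 0 <= \1_A z.1 * \1_(~` A) z.2 :> R by rewrite !indicE mulr_ge0.
rewrite /edge_int (EFin_Rint prob_fin); last 2 first.
- exact: (bmeas_kernel_Rint bE).
- by move=> x; apply: Rintegral_ge0 => y _; exact: (E0 (x, y)).
apply: eq_integral => x _.
rewrite (EFin_Rint (pker_fin x)); last 2 first.
- exact: (bmeas_slice x bE).
- by move=> y; exact: (E0 (x, y)).
have mE : measurable (edge_boundary A).
  rewrite (_ : edge_boundary A = A `*` ~` A)//.
  exact: measurableX mA (measurableC mA).
have mx := measurable_xsection x mE.
rewrite -[in RHS](setIT (xsection _ _)) -integral_indic//.
apply: eq_integral => y _; congr EFin.
rewrite !indicE -natrM mulnb; congr (nat_of_bool _)%:R.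
by apply/andP/idP; rewrite /xsection/edge_boundary !inE /= ?inE /= ?inE.
Qed.

End kernel_integral.

(** * Integration against a mixture of measures *)

Section mixture.
Local Open Scope ereal_scope.
Context d d' (Y : measurableType d) (M : measurableType d') (R : realType).
Variables (m : {measure set Y -> \bar R}) (D : set Y).
Variables (Q : Y -> {measure set M -> \bar R}) (m' : {measure set M -> \bar R}).
Hypothesis mD : measurable D.
Hypothesis mQ : forall B, measurable B -> measurable_fun [set: Y] (Q ^~ B).
Hypothesis mixE : forall B, measurable B -> m' B = \int[m]_(y in D) Q y B.

Import HBNNSimple.

Let mixture_nnsfun (f : {nnsfun M >-> R}) :
  \int[m']_z (f z)%:E = \int[m]_(y in D) \int[Q y]_z (f z)%:E.
Proof.
under [in LHS]eq_integral do rewrite fimfunE -fsumEFin//.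
rewrite ge0_integral_fsum//; last 2 first.
  - by move=> r; exact/measurable_EFinP/measurableT_comp.
  - by move=> r z _; rewrite EFinM nnfun_muleindic_ge0.
under [in RHS]eq_integral.
  move=> y _.
  under eq_integral.
    by move=> z _; rewrite fimfunE -fsumEFin//; over.
  rewrite /= ge0_integral_fsum//; last 2 first.
    - by move=> r; exact/measurable_EFinP/measurableT_comp.
    - by move=> r z _; rewrite EFinM nnfun_muleindic_ge0.
  under eq_fsbigr.
    move=> r _.
    rewrite (integralZl_indic _ (fun r => f @^-1` [set r]))//; last first.
      by move=> r0; rewrite preimage_nnfun0.
    rewrite integral_indic// setIT.
    over.
  over.
rewrite /= ge0_integral_fsum//; last 2 first.
  - by move=> r; apply: measurable_funeM; apply: measurable_funTS; exact: mQ.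
  - move=> n y _.
    have := mulemu_ge0 (fun n => f @^-1` [set n]).
    by apply; exact: preimage_nnfun0.
apply: eq_fsbigr => r _.
rewrite (integralZl_indic _ (fun r => f @^-1` [set r]))//; last first.
  exact: preimage_nnfun0.
rewrite integral_indic// setIT mixE//.
have [r0|r0] := leP 0%R r.
  by rewrite ge0_integralZl//; apply: measurable_funTS; exact: mQ.
rewrite integral0_eq ?mule0; last first.
  by move=> y _; rewrite preimage_nnfun0// measure0.
by rewrite integral0_eq// => y _; rewrite preimage_nnfun0// measure0 mule0.
Qed.

(** Linearity gives simple functions, monotone convergence the rest. It serves twice: for the
    invariance of [mu] under [P], and for the one-step Markov property, where the mixing index is a
    sample point. *)
Lemma integral_mixture (g : M -> \bar R) : (forall z, 0 <= g z) ->
  measurable_fun [set: M] g -> \int[m']_z g z = \int[m]_(y in D) \int[Q y]_z g z.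
Proof.
move=> g0 mg; pose f_ := nnsfun_approx measurableT mg.
transitivity (\int[m']_z (lim ((f_ n z)%:E @[n --> \oo]))).
  by apply/eq_integral => z _; apply/esym/cvg_lim => //=; exact: cvg_nnsfun_approx.
rewrite monotone_convergence//; last 3 first.
  by move=> n; exact/measurable_EFinP.
  by move=> n z _; rewrite lee_fin.
  by move=> z _ a b ab; rewrite lee_fin; exact/lefP/nd_nnsfun_approx.
under eq_fun do rewrite mixture_nnsfun.
rewrite -monotone_convergence//; last 3 first.
- move=> n; apply: measurable_funTS.
  apply: (measurable_fun_integral_kernel mQ) => //.
    by move=> z; rewrite lee_fin.
  exact/measurable_EFinP.
- by move=> n y _; apply: integral_ge0 => // z _; rewrite lee_fin.
- move=> y _ a b ab; apply: ge0_le_integral => //.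
  + by move=> z _; rewrite lee_fin.
  + exact/measurable_EFinP.
  + exact/measurable_EFinP.
  + by move=> z _; rewrite lee_fin; exact/lefP/nd_nnsfun_approx.
apply: eq_integral => y _; rewrite -monotone_convergence//; last 3 first.
- by move=> n; exact/measurable_EFinP.
- by move=> n z _; rewrite lee_fin.
- by move=> z _ a b ab; rewrite lee_fin; exact/lefP/nd_nnsfun_approx.
by apply: eq_integral => z _; apply/cvg_lim => //; exact: cvg_nnsfun_approx.
Qed.

End mixture.

Section restriction.
Local Open Scope ereal_scope.

Lemma ge0_integral_mrestr d (T : measurableType d) (R : realType)
    (m : {measure set T -> \bar R}) (D : set T) (mD : measurable D) (f : T -> \bar R) :
  measurable_fun [set: T] f -> (forall x, 0 <= f x) ->
  \int[mrestr m mD]_x f x = \int[m]_(x in D) f x.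
Proof.
move=> mf f0; rewrite -(setUv D) ge0_integral_setU//=; last 3 first.
- exact: measurableC.
- exact: measurable_funTS.
- by rewrite disj_set2E setICr.
rewrite (@eq_measure_integral _ _ _ _ m) => [|A mA AD]; last first.
  by congr (m _); exact/setIidl.
rewrite -[RHS]adde0; congr (_ + _).
rewrite (@eq_measure_integral _ _ _ _ mzero) ?integral_measure_zero// => A mA AD.
transitivity (m set0); last by rewrite measure0.
by congr (m _); apply/seteqP; split=> // x [/AD].
Qed.

End restriction.

Section monotone.
Local Open Scope ereal_scope.

Lemma monotone_cvg_integral d (T : measurableType d) (R : realType)
    (m : {measure set T -> \bar R}) (u : nat -> T -> \bar R) (l : T -> \bar R) :
  (forall n, measurable_fun [set: T] (u n)) -> (forall n x, 0 <= u n x) ->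
  (forall x, {homo u ^~ x : i j / (i <= j)%N >-> i <= j}) ->
  (forall x, u n x @[n --> \oo] --> l x) ->
  \int[m]_x u n x @[n --> \oo] --> \int[m]_x l x.
Proof.
move=> mu u0 nd ul.
rewrite (_ : l = fun x => limn (u ^~ x)); last first.
  by apply/funext => x; apply/esym/cvg_lim => //; exact: ul.
by apply: cvg_monotone_convergence => // x _; exact: nd.
Qed.

End monotone.

(** * Coarea formula and Cheeger inequality *)

Section discretization.
Variable R : realType.

Lemma le0_archimedean (a b : R) : (forall n, n%:R * a <= b) -> a <= 0.
Proof.
move=> H; rewrite leNgt; apply/negP => a0.
have := H (Num.truncn (b / a)).+1; rewrite leNgt => /negP; apply.
by rewrite -ltr_pdivrMr// truncnS_gt.
Qed.

Lemma bmeas_nat_bound d (T : measurableType d) (g : T -> R) : bmeas g ->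
  exists C : nat, forall x, g x <= C%:R.
Proof.
move=> [_ [C gC]]; exists (Num.truncn C).+1 => x.
by rewrite (le_trans (ler_norm _))// (le_trans (gC x))// ltW// truncnS_gt.
Qed.

End discretization.

Section level_sets.
Context d (M : measurableType d) (R : realType) (g : M -> R).
Hypothesis mg : measurable_fun [set: M] g.

(** The superlevel set at height i/n, with the division cleared so that n = 0 is no exception. *)
Definition level (n i : nat) : set M := [set x | i%:R < n%:R * g x].

Lemma measurable_level n i : measurable (level n i).
Proof.
rewrite -[level n i]setTI; apply: (measurable_fun_ltr (f := cst i%:R)
  (g := fun x => n%:R * g x)) => //.
by apply: measurable_funM => //; exact: measurable_cst.
Qed.

Lemma indic_level n i x : \1_(level n i) x = (i%:R < n%:R * g x)%R%:R :> R.
Proof. by rewrite indicE; congr (nat_of_bool _)%:R; apply/idP/idP; rewrite inE. Qed.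

Lemma indic_levelC n i x : \1_(~` level n i) x = (n%:R * g x <= i%:R)%R%:R :> R.
Proof.
rewrite indicE leNgt; congr (nat_of_bool _)%:R.
by apply/idP/negP; rewrite inE.
Qed.

End level_sets.

Section coarea.
Context d (M : measurableType d) (R : realType).
Variables (mu : probability M R) (P : R.-pker M ~> M).
Local Notation J := (edge_int mu P).

Let bmeas1 (f : M -> R) : bmeas f -> bmeas (fun z : M * M => f z.1).
Proof. by apply: bmeas_comp; exact: measurable_fst. Qed.
Let bmeas2 (f : M -> R) : bmeas f -> bmeas (fun z : M * M => f z.2).
Proof. by apply: bmeas_comp; exact: measurable_snd. Qed.

(** A discrete layer-cake argument. The number of levels i/n below g(x) is at least n g(x), while
    the number of levels separating the ends of an edge exceeds n times the drop by at most 1. Hence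
    n times the defect is at most 1 for every n. *)
Lemma coarea (m : {measure set M -> \bar R}) (r : R) (g : M -> R) :
  (m setT < +oo)%E -> 0 <= r -> bmeas g ->
  (forall B, measurable B -> B `<=` [set x | 0 < g x] ->
    r * fine (m B) <= J (fun z => \1_B z.1 * \1_(~` B) z.2)) ->
  r * \int[m]_x g x <= J (fun z => Num.max (g z.1 - g z.2) 0).
Proof.
move=> mfin r0 bg H; rewrite -subr_le0; apply: (@le0_archimedean _ _ 1) => n.
have [C gC] := bmeas_nat_bound bg.
have mg := bmeas_measurable bg.
have blev i : bmeas (\1_(level g n i) : M -> R) by exact: bmeas_indic (measurable_level mg n i).
have blevC i : bmeas (\1_(~` level g n i) : M -> R).
  exact: bmeas_indic (measurableC (measurable_level mg n i)).
have bpos : bmeas (fun z : M * M => Num.max (g z.1 - g z.2) 0).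
  have bd : bmeas (fun z : M * M => g z.1 - g z.2).
    by apply: bmeasB; [exact: bmeas1|exact: bmeas2].
  split; first by apply: measurable_maxr => //; case: bd.
  have [_ [D hD]] := bd; exists D => z.
  by case: (leP (g z.1 - g z.2) 0) => _ //; rewrite normr0 (le_trans _ (hD z)).
rewrite mulrBr lerBlDr mulrCA.
have -> : n%:R * J (fun z => Num.max (g z.1 - g z.2) 0) =
    J (fun z => n%:R * Num.max (g z.1 - g z.2) 0) by rewrite edge_intZ.
rewrite -[X in _ <= X + _](edge_int_cst mu P 1) -edge_intD; last 2 first.
- exact: bmeas_cst.
- by apply: bmeasM => //; exact: bmeas_cst.
apply: (@le_trans _ _ (J (fun z => \sum_(i < n * C)
    \1_(level g n i) z.1 * \1_(~` level g n i) z.2))); last first.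
  apply: le_edge_int => [||z].
  - by apply: bmeas_sum => i; apply: bmeasM; [exact: bmeas1|exact: bmeas2].
  - by apply: bmeasD; [exact: bmeas_cst|apply: bmeasM => //; exact: bmeas_cst].
  - rewrite addrC maxr_pMr// mulr0 mulrBr.
    apply: le_trans (count_between _ _ (n * C)).
    apply: ler_sum => i _; rewrite indic_level indic_levelC -natrM mulnb.
    by rewrite andbC.
rewrite edge_int_sum => [|i]; last by apply: bmeasM; [exact: bmeas1|exact: bmeas2].
apply: (@le_trans _ _ (\sum_(i < n * C) r * fine (m (level g n i)))); last first.
  apply: ler_sum => i _; apply: H; first exact: measurable_level.
  move=> x; rewrite /level/= => /(le_lt_trans (ler0n _ _)).
  by case: n {blev blevC i} => [|n]; rewrite ?mul0r ?ltxx// pmulr_rgt0.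
rewrite -mulr_sumr ler_wpM2l//.
under eq_bigr => i _ do rewrite -(Rint_indic m (measurable_level mg n i)).
rewrite -(Rint_sum mfin)//.
rewrite -(RintZ mfin)//; apply: le_Rint => //.
- by apply: bmeasM => //; exact: bmeas_cst.
- exact: bmeas_sum.
move=> x; under eq_bigr do rewrite indic_level.
by apply: count_below; rewrite natrM ler_wpM2l.
Qed.

Hypothesis Prev : reversible mu P.

(** Reversibility on the rectangle B x M says that [mu] is invariant under [P]. This extends to
    nonnegative functions, then to bounded ones by adding a constant. *)
Lemma edge_int_snd (g : M -> R) : bmeas g -> J (fun z => g z.2) = \int[mu]_x g x.
Proof.
have inv (B : set M) : measurable B -> mu B = (\int[mu]_x P x B)%E.
  move=> mB; have mTB : measurable (B `*` [set: M]) by exact: measurableX.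
  have := Prev mTB; rewrite /edge_measure => E.
  transitivity (\int[mu]_x P x (xsection (B `*` [set: M]) x))%E.
    transitivity (\int[mu]_x (\1_B x)%:E)%E; first by rewrite integral_indic// setIT.
    apply: eq_integral => x _; rewrite indicE; case: (pselect (B x)) => Bx.
      rewrite (mem_set Bx) (_ : xsection _ x = setT) ?(@prob_kernel _ _ _ _ _ P x)//.
      by apply/seteqP; split=> y; rewrite /xsection /= ?inE.
    rewrite (memNset Bx) (_ : xsection _ x = set0) ?measure0//.
    by apply/seteqP; split=> y; rewrite /xsection /= ?inE /=; tauto.
  rewrite E; apply: eq_integral => x _; congr (P x _).
  by apply/seteqP; split=> y; rewrite /xsection /= inE /=; tauto.
have pos (h : M -> R) : bmeas h -> (forall x, 0 <= h x) ->
    J (fun z => h z.2) = \int[mu]_x h x.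
  move=> bh h0; apply: EFin_inj.
  have mh : measurable_fun [set: M] (EFin \o h) by apply/measurable_EFinP; case: bh.
  rewrite /edge_int !(EFin_Rint (prob_fin mu))//.
  - rewrite [RHS](integral_mixture (D := setT) measurableT (measurable_kernel P) inv)//.
    by apply: eq_integral => x _; rewrite (EFin_Rint (pker_fin P x)).
  - exact: (bmeas_kernel_Rint P (bmeas2 bh)).
  - by move=> x; apply: Rintegral_ge0.
move=> bg; have [_ [C gC]] := bg.
have bC : bmeas (fun _ : M => C : R) by exact: bmeas_cst.
have gC0 x : 0 <= g x + C by have := gC x; rewrite ler_norml => /andP[]; lra.
have := pos _ (bmeasD bg bC) gC0.
rewrite (edge_intD mu P (bmeas2 bg) (bmeas2 bC)) (RintD (prob_fin mu) bg bC).
by rewrite (edge_int_fst mu P bC) => /addIr.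
Qed.


End coarea.

Section cheeger.
Context d (M : measurableType d) (R : realType).
Variables (mu : probability M R) (P : R.-pker M ~> M).
Hypothesis Prev : reversible mu P.
Local Notation J := (edge_int mu P).

Let bmeas1 (f : M -> R) : bmeas f -> bmeas (fun z : M * M => f z.1).
Proof. by apply: bmeas_comp; exact: measurable_fst. Qed.
Let bmeas2 (f : M -> R) : bmeas f -> bmeas (fun z : M * M => f z.2).
Proof. by apply: bmeas_comp; exact: measurable_snd. Qed.

Lemma bmeas_edge_sqr (f : M -> R) : bmeas f ->
  bmeas (fun z : M * M => (f z.1 - f z.2) ^+ 2).
Proof. by move=> bf; apply/bmeasX/bmeasB; [exact: bmeas1|exact: bmeas2]. Qed.

(** Coarea for psi^2 bounds both r1 a and r2 b by the same flow X, and X <= (2 / r1) E + (r1 / 2) a.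
    Since r1 a <= X, the last term is absorbed and X <= (4 / r1) E; the bound on r2 b then gives the
    product. *)
Lemma cheeger_real (m : {measure set M -> \bar R}) (r1 r2 : R) (psi : M -> R) :
  (m setT < +oo)%E -> 0 <= r1 -> 0 <= r2 -> bmeas psi -> (forall x, 0 <= psi x) ->
  (forall B, measurable B -> B `<=` [set x | 0 < psi x] ->
    r1 * fine (mu B) <= J (fun z => \1_B z.1 * \1_(~` B) z.2)) ->
  (forall B, measurable B -> B `<=` [set x | 0 < psi x] ->
    r2 * fine (m B) <= J (fun z => \1_B z.1 * \1_(~` B) z.2)) ->
  r1 * r2 * \int[m]_x psi x ^+ 2 <= 4 * J (fun z => (psi z.1 - psi z.2) ^+ 2).
Proof.
move=> mfin r1_ge0 r2_ge0 bpsi psi0 H1 H2.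
have bpsi2 : bmeas (fun x => psi x ^+ 2) by exact: bmeasX.
have lev B : B `<=` [set x | 0 < psi x ^+ 2] -> B `<=` [set x | 0 < psi x].
  by move=> BS x /BS /=; rewrite exprn_even_gt0//= lt0r psi0 andbT.
have C1 := coarea (prob_fin mu) r1_ge0 bpsi2 (fun B mB BS => H1 B mB (lev B BS)).
have C2 := coarea mfin r2_ge0 bpsi2 (fun B mB BS => H2 B mB (lev B BS)).
set X := J _ in C1 C2; set a := \int[mu]_x _ in C1; set b := \int[m]_x _ in C2 *.
set E := J _.
have E0 : 0 <= E by apply: edge_int_ge0 => z; exact: sqr_ge0.
have [r10|] := eqVneq r1 0; first by rewrite r10 !mul0r mulr_ge0.
rewrite neq_lt ltNge r1_ge0/= => r1_gt0.
(* AM-GM with the weight 4 / r1, which is optimal up to a constant. *)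
have XE : X <= 2 / r1 * E + r1 / 2 * a.
  have b1 : bmeas (fun z : M * M => r1 / 4 * psi z.1 ^+ 2).
    by apply: bmeasM; [exact: bmeas_cst|exact: (bmeas1 bpsi2)].
  have b2 : bmeas (fun z : M * M => r1 / 4 * psi z.2 ^+ 2).
    by apply: bmeasM; [exact: bmeas_cst|exact: (bmeas2 bpsi2)].
  have b3 : bmeas (fun z : M * M => 2 / r1 * (psi z.1 - psi z.2) ^+ 2).
    by apply: bmeasM; [exact: bmeas_cst|exact: bmeas_edge_sqr].
  have bR := bmeasD b3 (bmeasD b1 b2).
  have -> : 2 / r1 * E + r1 / 2 * a = J (fun z => 2 / r1 * (psi z.1 - psi z.2) ^+ 2 +
      (r1 / 4 * psi z.1 ^+ 2 + r1 / 4 * psi z.2 ^+ 2)).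
    rewrite (edge_intD mu P b3 (bmeasD b1 b2)) (edge_intD mu P b1 b2).
    rewrite (edge_intZ mu P (2 / r1) (bmeas_edge_sqr bpsi)).
    rewrite (edge_intZ mu P (r1 / 4) (bmeas1 bpsi2)).
    rewrite (edge_intZ mu P (r1 / 4) (bmeas2 bpsi2)).
    rewrite (edge_int_fst mu P bpsi2) (edge_int_snd Prev bpsi2) -/E -/a.
    by rewrite -mulrDr; congr (_ + _); field.
  have le z : Num.max (psi z.1 ^+ 2 - psi z.2 ^+ 2) 0 <=
      2 / r1 * (psi z.1 - psi z.2) ^+ 2 +
      (r1 / 4 * psi z.1 ^+ 2 + r1 / 4 * psi z.2 ^+ 2).
    set p := psi z.1; set q := psi z.2.
    have r4 : 0 <= r1 / 4 by rewrite divr_ge0.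
    have r2' : 0 <= 2 / r1 by rewrite divr_ge0.
    rewrite ge_max; apply/andP; split; last first.
      by rewrite !addr_ge0// mulr_ge0// sqr_ge0.
    rewrite -subr_ge0.
    (* Write p^2 - q^2 = (p - q)(p + q), complete the square, and use (p + q)^2 + (p - q)^2 = 2 (p^2
       + q^2). *)
    have -> : 2 / r1 * (p - q) ^+ 2 + (r1 / 4 * p ^+ 2 + r1 / 4 * q ^+ 2) -
        (p ^+ 2 - q ^+ 2) = 2 / r1 * ((p - q) - r1 / 4 * (p + q)) ^+ 2 +
        r1 / 8 * (p - q) ^+ 2 by field; rewrite gt_eqF.
    by rewrite addr_ge0// mulr_ge0 ?sqr_ge0// divr_ge0.
  apply: le_edge_int => //.
  split; last first.
    have [_ [D hD]] := bR; exists D => z.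
    rewrite ger0_norm ?le_max ?lexx ?orbT//; apply: le_trans (le z) _.
    by apply: le_trans (ler_norm _) (hD z).
  apply: measurable_maxr => //; apply: measurable_funB.
    by case: (bmeas1 bpsi2).
  by case: (bmeas2 bpsi2).
have h1 : r1 * a / 2 <= 2 / r1 * E by lra.
have h2 : r2 * b <= 4 / r1 * E by lra.
rewrite -mulrA (_ : 4 * E = r1 * (4 / r1 * E)); last by field; rewrite gt_eqF.
exact: ler_wpM2l.
Qed.

Variables (V : set M) (mV : measurable V).

(** As psi is bounded, positive mass of psi^2 on [V] makes [A] meet [V] in positive measure. Testing
    both infima on [A] itself shows that they are finite, and [cheeger_real] applies to their real
    values. *)
Lemma cheeger_test (psi : M -> R) : bmeas psi -> (forall x, 0 <= psi x) ->
  0 < \int[mrestr mu mV]_x psi x ^+ 2 ->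
  let A := [set x | 0 < psi x] in
  pos_measurable mu A /\
  (mule_top (rho mu P A) (rho' mu P V A) <=
    (4 * J (fun z => (psi z.1 - psi z.2) ^+ 2) /
      \int[mrestr mu mV]_x psi x ^+ 2)%:E)%E.
Proof.
move=> bpsi psi0 b0 A.
have mA : measurable A.
  rewrite -[A]setTI; apply: (measurable_fun_ltr (f := cst 0) (g := psi)) => //.
  by case: bpsi.
have mfin : (mrestr mu mV setT < +oo)%E.
  by rewrite /mrestr setTI -ge0_fin_numE// fin_num_measure.
set b := Rintegral _ _ _ in b0 *.
have AV0 : (0 < mu (A `&` V))%E.
  rewrite lt0e measure_ge0 andbT; apply/eqP => AV0.
  have bpsi2 : bmeas (fun x => psi x ^+ 2) by exact: bmeasX.
  have [C psiC] := bmeas_nat_bound bpsi2.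
  have bA := bmeas_indic R mA.
  suff : b <= C%:R * fine (mrestr mu mV A) by rewrite /mrestr AV0 mulr0 leNgt b0.
  rewrite -Rint_indic// -(RintZ mfin)//; apply: le_Rint => // [|x].
    by apply: bmeasM => //; exact: bmeas_cst.
  rewrite indicE; case: (pselect (A x)) => Ax; first by rewrite mem_set// mulr1.
  rewrite memNset// mulr0 (_ : psi x = 0) ?expr0n//.
  by apply/eqP; rewrite eq_le psi0 andbT leNgt; exact/negP.
have muA0 : (0 < mu A)%E.
  apply: lt_le_trans AV0 _; apply: le_measure; rewrite ?inE//.
  exact: measurableI.
have pA : pos_measurable mu A by split=> //; rewrite muA0 probability_le1.
split=> //.
have edge_ge0 B : measurable B -> (0 <= edge_measure mu P (edge_boundary B))%E.
  by move=> mB; apply: integral_ge0.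
have muV B : measurable B -> mu (B `&` V) \is a fin_num.
  by move=> mB; rewrite fin_num_measure//; exact: measurableI.
have rho_ge0 : (0 <= rho mu P A)%E.
  apply: le_ereal_inf_tmp => _ [B [[mB _] _] <-].
  by rewrite mule_ge0 ?edge_ge0// lee_fin invr_ge0 fine_ge0.
have rho'_ge0 : (0 <= rho' mu P V A)%E.
  apply: le_ereal_inf_tmp => _ [B [[mB _] _] <-]; rewrite /eta'.
  case: ifP => // _.
  by rewrite mule_ge0 ?edge_ge0// lee_fin invr_ge0 fine_ge0.
have edge_fin B : measurable B -> edge_measure mu P (edge_boundary B) =
    (J (fun z => \1_B z.1 * \1_(~` B) z.2))%:E.
  by move=> mB; rewrite edge_int_boundary.
have rho_fin : rho mu P A \is a fin_num.
  rewrite ge0_fin_numE//; apply: (@le_lt_trans _ _ (eta mu P A)).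
    by apply: ereal_inf_lbound; exists A => //; split.
  by rewrite /eta edge_fin// -EFinM ltry.
have rho'_fin : rho' mu P V A \is a fin_num.
  rewrite ge0_fin_numE//; apply: (@le_lt_trans _ _ (eta' mu P V A)).
    by apply: ereal_inf_lbound; exists A => //; split.
  by rewrite /eta' gt_eqF// edge_fin// -EFinM ltry.
(* The infimum ranges over sets of positive measure only; null sets satisfy the inequality because
   the boundary term is nonnegative. *)
have H1 B : measurable B -> B `<=` A ->
    fine (rho mu P A) * fine (mu B) <= J (fun z => \1_B z.1 * \1_(~` B) z.2).
  move=> mB BA; have [muB0|muB0] := eqVneq (mu B) 0%E.
    rewrite muB0 mulr0; apply: edge_int_ge0 => z; rewrite !indicE mulr_ge0//.
  have muB : (0 < mu B)%E by rewrite lt0e muB0 measure_ge0.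
  rewrite -ler_pdivlMr ?fine_gt0 ?muB ?ltey_eq ?fin_num_measure//.
  rewrite -lee_fin fineK// EFinM -edge_fin//.
  apply: ereal_inf_lbound; exists B => //; split=> //; split=> //.
  by rewrite muB probability_le1.
have H2 B : measurable B -> B `<=` A ->
    fine (rho' mu P V A) * fine (mrestr mu mV B) <=
    J (fun z => \1_B z.1 * \1_(~` B) z.2).
  move=> mB BA; have [muB0|muB0] := eqVneq (mu (B `&` V)) 0%E.
    rewrite /mrestr muB0 mulr0; apply: edge_int_ge0 => z; rewrite !indicE mulr_ge0//.
  have muB : (0 < mu (B `&` V))%E by rewrite lt0e muB0 measure_ge0.
  rewrite -ler_pdivlMr ?fine_gt0 /mrestr ?muB ?ltey_eq ?muV//.
  rewrite -lee_fin fineK// EFinM -edge_fin//.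
  rewrite (_ : _ * _ = eta' mu P V B)%E; last by rewrite /eta' (negPf muB0).
  apply: ereal_inf_lbound; exists B => //; split=> //; split=> //.
  rewrite probability_le1// andbT; apply: lt_le_trans muB _.
  by apply: le_measure; rewrite ?inE//; exact: measurableI.
have := cheeger_real mfin (fine_ge0 rho_ge0) (fine_ge0 rho'_ge0) bpsi psi0 H1 H2.
rewrite -/b -ler_pdivlMr// -lee_fin EFinM !fineK// => H.
(* Both factors being finite, the convention for 0 times +oo is never invoked. *)
rewrite /mule_top; case: ifP => // /orP[] /andP[/eqP h1 /eqP h2].
  by move: rho'_fin; rewrite h2.
by move: rho_fin; rewrite h1.
Qed.

End cheeger.

(** * Localization *)

Section measurability.
Context d (T : measurableType d) (R : realType).

Lemma measurable_funV (f : T -> R) : measurable_fun [set: T] f ->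
  (forall x, 0 <= f x) -> measurable_fun [set: T] (fun x => (f x)^-1).
Proof.
move=> mf f0; rewrite (_ : (fun x => _) = (@powR R ^~ (-1)) \o f).
  exact: measurableT_comp (measurable_powR _) mf.
by apply/funext => x /=; rewrite powR_inv1.
Qed.

Lemma measurable_fun_sqrt (f : T -> R) : measurable_fun [set: T] f ->
  (forall x, 0 <= f x) -> measurable_fun [set: T] (fun x => Num.sqrt (f x)).
Proof.
move=> mf f0; rewrite (_ : (fun x => _) = (@powR R ^~ (2^-1)) \o f).
  exact: measurableT_comp (measurable_powR _) mf.
by apply/funext => x /=; rewrite powR12_sqrt.
Qed.

Lemma bmeas_bigmin (I : Type) (s : seq I) (c : R) (G : I -> T -> R) :
  (forall i, bmeas (G i)) -> bmeas (fun x => \big[Num.min/c]_(i <- s) G i x).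
Proof.
move=> bG; elim: s => [|i s IH].
  by under eq_fun do rewrite big_nil; exact: bmeas_cst.
by under eq_fun do rewrite big_cons; exact: bmeas_min.
Qed.

Lemma bmeas_lt (f g : T -> R) : bmeas f -> bmeas g ->
  measurable_fun [set: T] (fun x => f x < g x).
Proof. by move=> [mf _] [mg _]; exact: measurable_fun_ltr. Qed.

Lemma bmeas_near_walls N B j (f g : T -> R) : bmeas f -> bmeas g ->
  bmeas (fun x => near_walls N B j (f x) (g x)).
Proof.
move=> bf bg; apply: bmeas_sum => c; apply: bmeas_bool; apply: measurable_and.
  apply: bmeas_lt; last exact: bmeas_cst.
  by apply: bmeasB; [exact: bmeas_min|exact: bmeas_cst].
apply: bmeas_lt; first exact: bmeas_cst.
apply: bmeasD; last exact: bmeas_cst.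
rewrite (_ : (fun x => _) = (fun x => - Num.min (- f x) (- g x))).
  by apply/bmeasN/bmeas_min; exact: bmeasN.
by apply/funext => x; rewrite -oppr_max opprK.
Qed.

Lemma bmeas_fin_eq (I : finType) (h : T -> {ffun I -> bool}) (C : {ffun I -> bool}) :
  (forall i, measurable_fun [set: T] (fun x => h x i)) ->
  bmeas (fun x => (h x == C)%:R : R).
Proof.
move=> mh; apply: bmeas_bool.
rewrite (_ : (fun x => _) = (fun x => \big[andb/true]_i (h x i == C i))).
  elim: (index_enum I) => [|i s IH].
    by under eq_fun do rewrite big_nil; exact: measurable_cst.
  under eq_fun do rewrite big_cons; apply: measurable_and => //.
  case: (C i).
    by rewrite (_ : (fun x => _) = h ^~ i)//; apply/funext => x; exact: eqb_id.
  rewrite (_ : (fun x => _) = fun x => ~~ h x i); first exact: measurable_neg.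
  by apply/funext => x; exact: eqbF_neg.
apply/funext => x; rewrite big_andE.
apply/idP/idP => [/eqP -> |/forallP H]; first by apply/forallP => i /=.
by apply/eqP/ffunP => i; have /eqP := H i.
Qed.

End measurability.

(** A round number above 2 * 66 * 1600 + 4 = 211204, the constant that comes out of
    [localization]. *)
Definition energy_cst (R : realType) : R := 300 * 1000.

Lemma energy_cst_gt0 (R : realType) : 0 < energy_cst R.
Proof. by apply: mulr_gt0; rewrite ltr0n. Qed.

Section localization.
Context d (M : measurableType d) (R : realType).
Variables (mu : probability M R) (P : R.-pker M ~> M).
Local Notation J := (edge_int mu P).
Variable nu : {measure set M -> \bar R}.
Hypothesis nufin : (nu setT < +oo)%E.
Variables (k : nat) (F : 'I_k -> M -> R).
Hypothesis k0 : (0 < k)%N.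
Hypothesis bF : forall i, bmeas (F i).

Let bmeas1 (f : M -> R) : bmeas f -> bmeas (fun z : M * M => f z.1).
Proof. by apply: bmeas_comp; exact: measurable_fst. Qed.
Let bmeas2 (f : M -> R) : bmeas f -> bmeas (fun z : M * M => f z.2).
Proof. by apply: bmeas_comp; exact: measurable_snd. Qed.

Let v x : 'I_k -> R := F ^~ x.
Let r x := nrm (v x).
(** In units where the layer has width 1, [N] is the side of a cell and the number of shifts, and
    [a] the scaling of directions. The ratio N / a = 1/(4k) is the side in the original scale; [N]
    is of order k^2 so that the mass lost in all k coordinates, 12 k^2 / N, is below 1/8.
    Coordinates of [U] lie in [0, 2a], whence [B]. *)
Let N := (100 * k ^ 2)%N.
Let a := (4 * k * N)%N.
Let B := (2 * a).+1.
Let U x : 'I_k -> R := fun i => a%:R * (dir (v x) i + 1).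

Let N0 : (0 < N)%N. Proof. by rewrite muln_gt0 expn_gt0 k0. Qed.
Let a0 : 0 < a%:R :> R. Proof. by rewrite ltr0n muln_gt0 N0 muln_gt0 k0. Qed.
Let kR0 : 0 < k%:R :> R. Proof. by rewrite ltr0n. Qed.
Let aE : a%:R = 4 * k%:R * N%:R :> R. Proof. by rewrite !natrM. Qed.
Let NE : N%:R = 100 * k%:R ^+ 2 :> R. Proof. by rewrite natrM natrX. Qed.

Let bsum : bmeas (fun x => \sum_i F i x ^+ 2).
Proof. by apply: bmeas_sum => i; exact: bmeasX. Qed.

Let br : bmeas r.
Proof.
have s0 x : 0 <= \sum_i F i x ^+ 2 by apply: sumr_ge0 => i _; exact: sqr_ge0.
apply: (@bmeas_dominated _ _ _ _ (fun x => \sum_i F i x ^+ 2 + 1)).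
- by apply: measurable_fun_sqrt => //; case: bsum.
- by apply: bmeasD => //; exact: bmeas_cst.
- move=> x; rewrite ger0_norm ?nrm_ge0// -[X in _ <= X + _]nrm_sqr.
  have := sqr_ge0 (r x - 1); rewrite -/(r x); have := nrm_ge0 (v x); rewrite -/(r x).
  nra.
Qed.

Let bU i : bmeas (fun x => U x i).
Proof.
apply: bmeasM; first exact: bmeas_cst.
apply: bmeasD; last exact: bmeas_cst.
apply: (@bmeas_dominated _ _ _ _ (fun=> 1)); last by move=> x; exact: dir_le1.
  apply: measurable_funM; first by case: (bF i).
  by apply: measurable_funV; [case: br|move=> x; exact: nrm_ge0].
exact: bmeas_cst.
Qed.

Let U_bound x i : 0 <= U x i < B%:R.
Proof.
have := dir_le1 (v x) i; rewrite ler_norml => /andP[h1 h2].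
have A0 := a0; apply/andP; split; first by apply: mulr_ge0; [exact: ltW|lra].
by rewrite /B -natr1 natrM /U; nra.
Qed.

Let r2E x : r x ^+ 2 = \sum_i F i x ^+ 2. Proof. exact: nrm_sqr. Qed.
Let br2 : bmeas (fun x => r x ^+ 2). Proof. exact: bmeasX. Qed.

Variable s : R.
Hypothesis s0 : 0 < s.
(** Approximate orthonormality enters only through this upper bound, which limits the mass of one
    cell, and through [tot], which bounds the total mass from below. *)
Hypothesis iso : forall w : 'I_k -> R, \sum_i w i ^+ 2 = 1 ->
  \int[nu]_x (\sum_i w i * F i x) ^+ 2 <= 1 + (16 * k%:R)^-1.
Hypothesis tot : k%:R - 16^-1 <= \int[nu]_x \sum_i F i x ^+ 2.
Hypothesis energy : \sum_i J (fun z => (F i z.1 - F i z.2) ^+ 2) <= 2 * k%:R * s.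

Let total_mass : \int[nu]_x r x ^+ 2 <= 2 * k%:R.
Proof.
under eq_Rintegral do rewrite r2E.
rewrite (Rint_sum nufin) => [|i]; last exact: bmeasX.
rewrite (_ : 2 * k%:R = \sum_(i < k) 2); last first.
  by rewrite sumr_const card_ord -[RHS]mulr_natr.
apply: ler_sum => i _.
have := iso (w := fun j => (j == i)%:R); rewrite (bigD1 i)//= eqxx expr1n big1.
  rewrite addr0 => /(_ erefl) H.
  have -> : \int[nu]_x F i x ^+ 2 = \int[nu]_x (\sum_j (j == i)%:R * F j x) ^+ 2.
    apply: eq_Rintegral => x _; congr (_ ^+ 2).
    rewrite (bigD1 i)//= eqxx mul1r big1 ?addr0// => j /negPf ->; exact: mul0r.
  apply: (le_trans H); rewrite (_ : 2 = 1 + 1 :> R)// lerD2l invf_le1 ?mulr_gt0//.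
  have : 1 <= k%:R :> R by rewrite ler1n.
  lra.
by move=> j /negPf ->; rewrite expr0n.
Qed.

(** The mass budget is 3 * 2k: at most 3 integers are counted around a point, and the total mass is
    at most 2k. The term a^2 s keeps the energy budget positive even if the energy vanishes, and is
    of an order already present. *)
Let shift (i : 'I_k) : exists j : 'I_N,
  \int[nu]_x (r x ^+ 2 * near_walls N B j (U x i) (U x i)) <= 12 * k%:R / N%:R /\
  J (fun z => r z.2 ^+ 2 * (Num.min 1 ((U z.1 i - U z.2 i) ^+ 2) *
      near_walls N B j (U z.1 i) (U z.2 i))) <=
  2 * (4 * J (fun z => r z.2 ^+ 2 * (U z.1 i - U z.2 i) ^+ 2) + a%:R ^+ 2 * s) / N%:R.
Proof.
have bU1 := bmeas1 (bU i). have bU2 := bmeas2 (bU i).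
have bD2 : bmeas (fun z : M * M => (U z.1 i - U z.2 i) ^+ 2) by exact/bmeasX/bmeasB.
have bcost j : bmeas (fun z : M * M => r z.2 ^+ 2 * (Num.min 1 ((U z.1 i - U z.2 i) ^+ 2) *
      near_walls N B j (U z.1 i) (U z.2 i))).
  apply: bmeasM; first exact: (bmeas2 br2).
  apply: bmeasM; first by apply: bmeas_min => //; exact: bmeas_cst.
  exact: bmeas_near_walls.
have bloss j : bmeas (fun x => r x ^+ 2 * near_walls N B j (U x i) (U x i)).
  by apply: bmeasM => //; exact: bmeas_near_walls.
have bE : bmeas (fun z : M * M => r z.2 ^+ 2 * (U z.1 i - U z.2 i) ^+ 2).
  by apply: bmeasM => //; exact: (bmeas2 br2).
rewrite (_ : 12 * k%:R = 2 * (6 * k%:R)); last by ring.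
apply: pigeonhole_pair => //.
- by move=> j; apply: Rintegral_ge0 => x _; rewrite mulr_ge0 ?sqr_ge0 ?near_walls_ge0.
- move=> j; apply: edge_int_ge0 => z.
  apply: mulr_ge0; [exact: sqr_ge0|apply: mulr_ge0; last exact: near_walls_ge0].
  by rewrite le_min ler01 sqr_ge0.
- by rewrite mulr_gt0.
- rewrite ltr_wpDl ?mulr_gt0 ?exprn_gt0// mulr_ge0//.
  by apply: edge_int_ge0 => z; rewrite mulr_ge0 ?sqr_ge0.
- rewrite -(Rint_sum nufin)//; apply: (@le_trans _ _ (\int[nu]_x (3 * r x ^+ 2))).
    apply: le_Rint => //; first exact: bmeas_sum.
      by apply: bmeasM => //; exact: bmeas_cst.
    move=> x; rewrite -mulr_sumr mulrC ler_wpM2r ?sqr_ge0//.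
    by apply: le_trans (sum_near_walls _ _ _ _) _; rewrite subrr normr0 add0r.
  rewrite (RintZ nufin)//; have := total_mass; lra.
- rewrite -(edge_int_sum mu P)//.
  apply: (@le_trans _ _ (J (fun z => 4 * (r z.2 ^+ 2 * (U z.1 i - U z.2 i) ^+ 2)))).
    apply: le_edge_int; first exact: bmeas_sum.
      by apply: bmeasM => //; exact: bmeas_cst.
    move=> z; rewrite -mulr_sumr mulrCA ler_wpM2l ?sqr_ge0//.
    exact: sum_wall_cost.
  by rewrite edge_intZ// lerDl mulr_ge0 ?sqr_ge0// ltW.
Qed.

Lemma localization : exists psi : 'I_k -> M -> R,
  [/\ forall l, bmeas (psi l), forall l x, 0 <= psi l x,
      forall l l' x, 0 < psi l x -> 0 < psi l' x -> l = l',
      forall l, 1 / 2 <= \int[nu]_x psi l x ^+ 2 &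
      forall l, J (fun z => (psi l z.1 - psi l z.2) ^+ 2) <= energy_cst R * k%:R ^+ 6 * s].
Proof.
have [j /all_and2[loss cost]] := choice shift.
pose phi x := cutoff B j (U x); pose c x := cell B j (U x).
have bphi : bmeas phi.
  apply: bmeas_bigmin => p; apply/bmeas_normr/bmeasB; first exact: bU.
  exact: bmeas_cst.
have bcell C : bmeas (fun x => (c x == C)%:R : R).
  apply: bmeas_fin_eq => p; under eq_fun do rewrite ffunE.
  by apply: measurable_fun_ler => //; case: (bU p.1).
have bphi1 : bmeas (fun x => (phi x == 1)%:R : R).
  by apply: bmeas_bool; apply: measurable_fun_eqr => //; case: bphi.
have bwt C : bmeas (fun x => r x ^+ 2 * ((c x == C)%:R * (phi x == 1)%:R)).
  by apply: bmeasM => //; exact: bmeasM.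
(* Only points where the cutoff equals 1 are counted, so the weight of a group is a lower bound for
   the mass of its psi^2. *)
pose w C := \int[nu]_x (r x ^+ 2 * ((c x == C)%:R * (phi x == 1)%:R)).
pose e : R := (4 * k%:R)^-1.
have e0 : 0 <= e by rewrite invr_ge0 mulr_ge0.
have k1 : 1 <= k%:R :> R by rewrite ler1n.
have ke : k%:R * e = 4^-1 by rewrite /e invfM mulrCA divff ?mulr1 ?gt_eqF.
have w_le C : 0 <= w C <= 1 + e.
  apply/andP; split.
    apply: Rintegral_ge0 => x _; apply: mulr_ge0; first exact: sqr_ge0.
    by rewrite mulr_ge0 ?ler0n.
  (* Freeze the direction [w0] of one point of the cell. On the whole cell the square of the
     combination of the F_i with coefficients [w0] is at least (1 - dl) r^2, and [iso] bounds its
     integral by 1 + dl; finally (1 + dl) / (1 - dl) <= 1 + 4 dl. *)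
  have [[x0 [x0C rx0]]|noC] := pselect (exists x, c x = C /\ r x != 0); last first.
    suff -> : w C = \int[nu]_x 0 by rewrite Rintegral_cst// mul0r addr_ge0.
    apply: eq_Rintegral => x _; have [xC|] := eqVneq (c x) C; last by rewrite mul0r mulr0.
    suff -> : r x = 0 by rewrite expr0n mul0r.
    by case: (eqVneq (r x) 0) => // rx; case: noC; exists x.
  pose w0 := dir (v x0).
  have NR0 : 0 < N%:R :> R by rewrite ltr0n.
  have := iso (dir_sqr rx0); rewrite -/w0 => iso0.
  have bw0 : bmeas (fun x => (\sum_i w0 i * F i x) ^+ 2).
    by apply/bmeasX/bmeas_sum => i; apply: bmeasM => //; exact: bmeas_cst.
  pose dl : R := (16 * k%:R)^-1.
  have dl0 : 0 < dl by rewrite invr_gt0 mulr_gt0.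
  have dle : e = 4 * dl by rewrite /e /dl; field; rewrite gt_eqF.
  have dl1 : dl <= 16^-1 by rewrite lef_pV2 ?posrE ?mulr_gt0//; lra.
  have : (1 - dl) * w C <= 1 + dl.
    apply: le_trans iso0; rewrite -(RintZ nufin)//; apply: le_Rint => //.
      by apply: bmeasM => //; exact: bmeas_cst.
    move=> x; have [xC|] := eqVneq (c x) C; last by rewrite !(mul0r, mulr0) sqr_ge0.
    have [rx|rx] := eqVneq (r x) 0; first by rewrite rx expr0n !(mul0r, mulr0) sqr_ge0.
    have dot : \sum_i w0 i * F i x = r x * \sum_i w0 i * dir (v x) i.
      by rewrite mulr_sumr; apply: eq_bigr => i _; rewrite mulrCA nrm_dir.
    (* Each of the k coordinates differs by at most N / a = 1/(4k), and k / (4k)^2 = [dl]. *)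
    have close : \sum_i (w0 i - dir (v x) i) ^+ 2 <= dl.
      have h i : (w0 i - dir (v x) i) ^+ 2 <= (4 * k%:R) ^- 2.
        have := cell_diam i (U_bound x0) (U_bound x) (etrans x0C (esym xC)).
        rewrite /U -mulrBr opprD addrACA subrr addr0 normrM (ger0_norm (ltW a0)) -/w0.
        rewrite aE => h.
        have {}h : 4 * k%:R * `|w0 i - dir (v x) i| <= 1.
          by rewrite -(ler_pM2r NR0) mul1r mulrAC.
        rewrite -exprVn -real_normK ?num_real// ler_pXn2r ?nnegrE ?invr_ge0 ?mulr_ge0//.
        by rewrite -[leRHS]mulr1 ler_pdivlMl// mulr_gt0.
      apply: le_trans (ler_sum _ (fun i _ => h i)) _.
      rewrite sumr_const card_ord -[leLHS]mulr_natr le_eqVlt; apply/orP; left.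
      by apply/eqP; rewrite /dl; field; rewrite gt_eqF.
    have sq : 1 - dl <= (\sum_i w0 i * dir (v x) i) ^+ 2.
      move: close; rewrite sum_sqrB !dir_sqr//; set t := \sum_i _ => ct.
      have : 1 - dl / 2 <= t by lra.
      nra.
    rewrite dot exprMn mulrCA ler_wpM2l ?sqr_ge0//.
    apply: le_trans sq; case: (phi x == 1) => /=; lra.
  rewrite dle => H.
  rewrite leNgt; apply/negP => wC; nra.
(* As k e = 1/4, the threshold is k - 1/4 - e; the loss 1/8 near the walls and the defect 1/16 of
   [tot] stay below 1/4. *)
have wtot : k%:R * (1 + e) - 1 / 2 - e <= \sum_C w C.
  have -> : \sum_C w C = \int[nu]_x (r x ^+ 2 * (phi x == 1)%:R).
    rewrite -(Rint_sum nufin)//; apply: eq_Rintegral => x _.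
    rewrite -mulr_sumr -mulr_suml; congr (_ * _).
    by rewrite (bigD1 (c x))//= eqxx big1 ?addr0 ?mul1r// => C; rewrite eq_sym => /negPf ->.
  have : \int[nu]_x r x ^+ 2 - \sum_i \int[nu]_x (r x ^+ 2 * near_walls N B (j i) (U x i) (U x i))
     <= \int[nu]_x (r x ^+ 2 * (phi x == 1)%:R).
    have bl i : bmeas (fun x => r x ^+ 2 * near_walls N B (j i) (U x i) (U x i)).
      by apply: bmeasM => //; exact: bmeas_near_walls.
    rewrite -(Rint_sum nufin)// -(RintB nufin)//; last exact: bmeas_sum.
    apply: le_Rint => //; first by apply: bmeasB => //; exact: bmeas_sum.
      exact: bmeasM.
    move=> x; rewrite -mulr_sumr -[X in X - _]mulr1 -mulrBr ler_wpM2l ?sqr_ge0//.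
    have := cutoff_near B j (U x); rewrite -/(phi x); case: eqP => _ /=; lra.
  have : \sum_i \int[nu]_x (r x ^+ 2 * near_walls N B (j i) (U x i) (U x i)) <= 8^-1.
    apply: le_trans (ler_sum _ (fun i _ => loss i)) _.
    rewrite sumr_const card_ord -[leLHS]mulr_natr NE.
    rewrite [leLHS](_ : _ = 12 / 100); first lra.
    by field; rewrite gt_eqF.
  have : k%:R - 16^-1 <= \int[nu]_x r x ^+ 2.
    by under eq_Rintegral do rewrite r2E.
  lra.
have [G [Gw Gdisj]] := greedy_groups e0 w_le wtot.
pose psi l x := r x * (phi x * (c x \in G l)%:R).
have bin l : bmeas (fun x => (c x \in G l)%:R : R).
  rewrite (_ : (fun x => _) = fun x => \sum_(C in G l) (c x == C)%:R).
    exact: bmeas_sum.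
  apply/funext => x; case: (boolP (c x \in G l)) => cG.
    by rewrite (bigD1 (c x))//= eqxx big1 ?addr0// => C /andP[_]; rewrite eq_sym => /negPf ->.
  by rewrite big1// => C CG; case: eqP => // cC; rewrite cC CG in cG.
have bchi l : bmeas (fun x => phi x * (c x \in G l)%:R) by exact: bmeasM.
have bpsi l : bmeas (psi l) by exact: bmeasM.
exists psi; split=> //.
- by move=> l x; rewrite !mulr_ge0 ?nrm_ge0 ?cutoff_ge0.
- move=> l l' x; rewrite /psi.
  case: (boolP (c x \in G l)) => [cl|]; last by rewrite !mulr0 ltxx.
  case: (boolP (c x \in G l')) => [cl' _ _|]; last by rewrite !mulr0 ltxx.
  by case: (eqVneq l l') => // /Gdisj /disjointFr /(_ cl); rewrite cl'.
- move=> l; apply: le_trans (Gw l) _; rewrite -(Rint_sum nufin)//.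
  apply: le_Rint => //; [exact: bmeas_sum|exact: bmeasX|move=> x].
  rewrite /psi exprMn -mulr_sumr ler_wpM2l ?sqr_ge0// exprMn -mulr_suml mulrC.
  apply: ler_pM; rewrite ?sumr_ge0//.
    by case: eqP => [->|_]; rewrite ?expr1n ?sqr_ge0.
  case: (boolP (c x \in G l)) => cG.
    rewrite (bigD1 (c x))//= eqxx big1 ?addr0 ?expr1n// => C /andP[_].
    by rewrite eq_sym => /negPf ->.
  by rewrite big1 ?sqr_ge0// => C CG; case: eqP => // cC; rewrite cC CG in cG.
- move=> l.
  have bFe i : bmeas (fun z : M * M => (F i z.1 - F i z.2) ^+ 2) by exact: bmeas_edge_sqr.
  have bcost i : bmeas (fun z : M * M => r z.2 ^+ 2 * (Num.min 1 ((U z.1 i - U z.2 i) ^+ 2) *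
      near_walls N B (j i) (U z.1 i) (U z.2 i))).
    apply: bmeasM; first exact: (bmeas2 br2).
    have bU1 := bmeas1 (bU i). have bU2 := bmeas2 (bU i).
    apply: bmeasM; last exact: bmeas_near_walls.
    by apply: bmeas_min; [exact: bmeas_cst|exact/bmeasX/bmeasB].
  have bUe i : bmeas (fun z : M * M => r z.2 ^+ 2 * (U z.1 i - U z.2 i) ^+ 2).
    by apply: bmeasM; [exact: (bmeas2 br2)|exact: (bmeas_edge_sqr (bU i))].
  have b1 : bmeas (fun z : M * M => 2 * \sum_i (F i z.1 - F i z.2) ^+ 2).
    by apply: bmeasM; [exact: bmeas_cst|exact: bmeas_sum].
  have b2 : bmeas (fun z : M * M => 2 * \sum_i r z.2 ^+ 2 * (Num.min 1 ((U z.1 i - U z.2 i) ^+ 2) *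
      near_walls N B (j i) (U z.1 i) (U z.2 i))).
    by apply: bmeasM; [exact: bmeas_cst|exact: bmeas_sum].
  (* With p, q the cutoff factors at x, y, the difference is (r x - r y) p + r y (p - q). The first
     term costs at most the energy of the F_i because p <= 1, the second is the wall cost weighted
     by r y^2. *)
  have step1 : J (fun z => (psi l z.1 - psi l z.2) ^+ 2) <=
      2 * (\sum_i J (fun z => (F i z.1 - F i z.2) ^+ 2)) +
      2 * \sum_i J (fun z => r z.2 ^+ 2 * (Num.min 1 ((U z.1 i - U z.2 i) ^+ 2) *
        near_walls N B (j i) (U z.1 i) (U z.2 i))).
    rewrite -!(edge_int_sum mu P)// -!edge_intZ; [|exact: bmeas_sum|exact: bmeas_sum].
    rewrite -edge_intD//; apply: le_edge_int; first exact: bmeas_edge_sqr.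
      exact: bmeasD.
    move=> [x y] /=; rewrite -mulr_sumr.
    have h1 : (r x - r y) ^+ 2 <= \sum_i (F i x - F i y) ^+ 2 by exact: nrmB_le.
    have := cutoff_cell_diff j (G l) (U x) (U y).
    rewrite -/(phi x) -/(phi y) -/(c x) -/(c y).
    have chi1 : (phi x * (c x \in G l)%:R) ^+ 2 <= 1.
      rewrite expr_le1 ?mulr_ge0 ?cutoff_ge0//.
      by case: (_ \in _); rewrite ?mulr1 ?mulr0// cutoff_le1.
    rewrite /psi; set p := phi x * _ in chi1 *; set q := phi y * _.
    set S := \sum_i Num.min _ _ * _; set T := \sum_i _ in h1 *.
    move=> h2.
    have h3 : r y ^+ 2 * (p - q) ^+ 2 <= r y ^+ 2 * S by rewrite ler_wpM2l ?sqr_ge0.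
    have h4 : (r x - r y) ^+ 2 * p ^+ 2 <= (r x - r y) ^+ 2 * 1 by rewrite ler_wpM2l ?sqr_ge0.
    have h5 := sqr_ge0 ((r x - r y) * p - r y * (p - q)).
    have -> : (r x * p - r y * q) ^+ 2 = 2 * ((r x - r y) ^+ 2 * p ^+ 2) +
       2 * (r y ^+ 2 * (p - q) ^+ 2) - ((r x - r y) * p - r y * (p - q)) ^+ 2 by ring.
    lra.
  have step2 : \sum_i J (fun z => r z.2 ^+ 2 * (U z.1 i - U z.2 i) ^+ 2) <=
      a%:R ^+ 2 * (8 * k%:R * s).
    rewrite -(edge_int_sum mu P)//.
    apply: (@le_trans _ _ (J (fun z => (a%:R ^+ 2 * 4) * \sum_i (F i z.1 - F i z.2) ^+ 2))).
      apply: le_edge_int; first exact: bmeas_sum.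
        by apply: bmeasM; [exact: bmeas_cst|exact: bmeas_sum].
      move=> [x y] /=; rewrite -mulr_sumr.
      have -> : \sum_i (U x i - U y i) ^+ 2 =
          a%:R ^+ 2 * \sum_i (dir (v x) i - dir (v y) i) ^+ 2.
        by rewrite mulr_sumr; apply: eq_bigr => i _; rewrite /U; ring.
      rewrite mulrCA -mulrA ler_wpM2l ?sqr_ge0//; exact: dirB_le.
    rewrite edge_intZ; last exact: bmeas_sum.
    rewrite (edge_int_sum mu P)// -mulrA; apply: ler_wpM2l; first exact: sqr_ge0.
    have := energy; lra.
  apply: le_trans step1 _.
  have step3 : \sum_i J (fun z => r z.2 ^+ 2 * (Num.min 1 ((U z.1 i - U z.2 i) ^+ 2) *
        near_walls N B (j i) (U z.1 i) (U z.2 i))) <=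
      2 / N%:R * (4 * (a%:R ^+ 2 * (8 * k%:R * s)) + k%:R * (a%:R ^+ 2 * s)).
    apply: le_trans (ler_sum _ (fun i _ => cost i)) _.
    rewrite -mulr_suml -mulr_sumr big_split/= sumr_const card_ord -[_ *+ k]mulr_natl.
    rewrite -mulr_sumr [leRHS]mulrAC ler_wpM2r ?invr_ge0 ?ler0n//.
    rewrite ler_wpM2l// lerD2r ler_wpM2l//.
  (* Here 66 = 2 (4 * 8 + 1) and a^2 / N = 16 k^2 N = 1600 k^4: the division by [N] is the gain from
     averaging. *)
  have E3 : 2 / N%:R * (4 * (a%:R ^+ 2 * (8 * k%:R * s)) + k%:R * (a%:R ^+ 2 * s)) =
     66 * 1600 * (k%:R ^+ 5 * s).
    rewrite aE NE; field; rewrite gt_eqF//.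
  rewrite E3 in step3; have := energy.
  have : k%:R ^+ 5 * s <= k%:R ^+ 6 * s.
    by rewrite ler_wpM2r ?(ltW s0)// ler_weXn2l.
  have : k%:R * s <= k%:R ^+ 6 * s.
    by rewrite ler_wpM2r ?(ltW s0)// -{1}[k%:R]expr1 ler_weXn2l.
  have : 0 <= k%:R ^+ 6 * s by rewrite mulr_ge0 ?exprn_ge0 ?ltW.
  rewrite /energy_cst; lra.
Qed.

End localization.

(** * The harmonic extension *)

Section hitting.
Local Open Scope ereal_scope.
Context d dO (R : realType) (M : measurableType d) (Omega : measurableType dO).
Variables (P : R.-pker M ~> M) (PP : M -> probability Omega R).
Variables (Z : nat -> Omega -> M) (PPZ : is_markov_chain P PP Z).
Variables (V : set M) (mV : measurable V).

Let mZ n : measurable_fun [set: Omega] (Z n). Proof. by case: PPZ. Qed.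

(** The event that the hitting time of [V] is at least n. *)
Definition avoid n : set Omega := [set w | forall i, (i < n)%N -> ~ V (Z i w)].

Lemma avoidS n : avoid n.+1 = avoid n `&` Z n @^-1` (~` V).
Proof.
apply/seteqP; split=> w /=.
  by move=> H; split; [move=> i ni; exact/H/ltnW|exact: H].
move=> [H1 H2] i; rewrite ltnS leq_eqVlt => /orP[/eqP -> //|]; exact: H1.
Qed.

(** The index n.+1 concerns times up to n only, which is exactly what the Markov property at time n
    accepts. *)
Lemma avoid_filtration n : natural_filtration Z n (avoid n.+1).
Proof.
rewrite (_ : avoid n.+1 = [set: Omega] `\`
   \bigcup_i (if (i <= n)%N then Z i @^-1` V else set0)); last first.
  apply/seteqP; split=> w /=.
    move=> H; split=> // -[i _]; case: ifP => // ni; exact: H.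
  by move=> [_ H] i ni Vi; apply: H; exists i => //; rewrite -ltnS ni.
apply: sigma_algebraCD; apply: sigma_algebra_bigcup => i.
case: ifP => [ni|_]; last exact: sigma_algebra0.
by apply: sub_sigma_algebra; exists i => //; exists V => //; rewrite setTI.
Qed.

Lemma measurable_avoid n : measurable (avoid n).
Proof.
elim: n => [|n IH]; first by rewrite (_ : avoid 0 = setT)//; apply/seteqP; split.
rewrite avoidS; apply: measurableI => //; rewrite -[X in measurable X]setTI.
by apply: mZ => //; exact: measurableC.
Qed.

(** One step of the chain killed on [V]; values in [0, +oo] leave room for unbounded functions. *)
Definition killed (g : M -> \bar R) (x : M) : \bar R :=
  ((fun x => \int[P x]_y g y) \_ (~` V)) x.

Lemma killed_ge0 g : (forall x, 0 <= g x) -> forall x, 0 <= killed g x.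
Proof. by move=> g0 x; apply: erestrict_ge0 => y _; apply: integral_ge0. Qed.

Lemma measurable_kernel_integral (g : M -> \bar R) : (forall x, 0 <= g x) ->
  measurable_fun [set: M] g -> measurable_fun [set: M] (fun x => \int[P x]_y g y).
Proof.
move=> g0 mg; apply: (measurable_fun_integral_kernel (measurable_kernel P)) => //.
Qed.

Lemma measurable_killed g : (forall x, 0 <= g x) -> measurable_fun [set: M] g ->
  measurable_fun [set: M] (killed g).
Proof.
move=> g0 mg; apply/(measurable_restrictT _ _).1; first exact: measurableC.
exact/measurable_funTS/measurable_kernel_integral.
Qed.

Lemma iter_killed g n : (forall x, 0 <= g x) -> measurable_fun [set: M] g ->
  (forall x, 0 <= iter n killed g x) /\ measurable_fun [set: M] (iter n killed g).
Proof.
move=> g0 mg; elim: n => [//|n [IH0 IHm]] /=.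
by split; [exact: killed_ge0|exact: measurable_killed].
Qed.

Lemma integral_start x g : (forall x, 0 <= g x) -> measurable_fun [set: M] g ->
  \int[PP x]_w g (Z 0 w) = g x.
Proof.
move=> g0 mg.
have <- : \int[pushforward (PP x) (Z 0)]_y g y = \int[PP x]_w g (Z 0 w).
  by rewrite ge0_integral_pushforward.
rewrite (@eq_measure_integral _ _ _ _ \d_x) => [|A mA _]; last first.
  by case: PPZ => _ + _; exact.
by rewrite integral_dirac// diracT mul1e.
Qed.

Lemma integral_avoidS x g n : (forall x, 0 <= g x) -> measurable_fun [set: M] g ->
  \int[PP x]_(w in avoid n.+1) g (Z n.+1 w) =
  \int[PP x]_(w in avoid n) killed g (Z n w).
Proof.
move=> g0 mg; have mE := measurable_avoid n.+1.
(* The sub-probability law of Z(n+1) on the event of avoiding [V] up to time n. The Markov property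
   presents it as a mixture of the measures [P (Z n w)]. *)
pose law : {measure set M -> \bar R} :=
  measure_function_pushforward__canonical__measure_function_Measure
    (mrestr (PP x) mE) (mZ n.+1).
transitivity (\int[law]_y g y).
  rewrite ge0_integral_pushforward// preimage_setT ge0_integral_mrestr//.
    exact: measurableT_comp.
  by move=> w; exact: g0.
rewrite (@integral_mixture _ _ _ _ _ (PP x) (avoid n.+1) (fun w => P (Z n w)) law)//.
- rewrite avoidS integral_mkcondr; apply: eq_integral => w _.
  by rewrite /killed /patch.
- move=> B mB; exact: measurableT_comp (measurable_kernel P B mB) (mZ n).
- move=> B mB; case: PPZ => _ _ H.
  by rewrite -H//; [rewrite setIC|exact: avoid_filtration].
Qed.

Lemma integral_avoid x g n : (forall x, 0 <= g x) -> measurable_fun [set: M] g ->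
  \int[PP x]_(w in avoid n) g (Z n w) = iter n killed g x.
Proof.
elim: n g => [|n IH] g g0 mg.
  rewrite (_ : avoid 0 = setT) ?integral_start//; by apply/seteqP; split.
rewrite integral_avoidS// IH ?iterSr//; [exact: killed_ge0|exact: measurable_killed].
Qed.

End hitting.

Section hitting_value.
Local Open Scope ereal_scope.
Context d dO (R : realType) (M : measurableType d) (Omega : measurableType dO).
Variables (P : R.-pker M ~> M) (PP : M -> probability Omega R).
Variables (Z : nat -> Omega -> M) (PPZ : is_markov_chain P PP Z).
Variables (V : set M) (mV : measurable V).
Implicit Types f g : M -> R.

Local Notation avoidV := (avoid Z V).
Local Notation killedV := (killed P V).

Let mZ n : measurable_fun [set: Omega] (Z n). Proof. by case: PPZ. Qed.

Definition hit_at n : set Omega := avoidV n `&` Z n @^-1` V.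

Definition hit_value f (w : Omega) : R :=
  if hitting_time Z V w is Some n then f (Z n w) else 0%R.

Lemma hit_at_inj n m w : hit_at n w -> hit_at m w -> n = m.
Proof.
move=> [n1 n2] [m1 m2]; apply/eqP; rewrite eqn_leq.
by apply/andP; split; rewrite leqNgt; apply/negP => lt; [exact: n1 lt m2|exact: m1 lt n2].
Qed.

Lemma hitting_time_spec w :
  if hitting_time Z V w is Some n then hit_at n w else forall n, ~ hit_at n w.
Proof.
rewrite /hitting_time; case: pselect => [e|ne].
  case: ex_minnP => n /asboolP Vn minn; split=> // i ni Vi.
  by have := minn i; rewrite leqNgt ni => /(_ (asboolT Vi)).
by move=> n [_ Vn]; apply: ne; exists n; exact/asboolP.
Qed.

Lemma measurable_hit_at n : measurable (hit_at n).
Proof.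
apply: measurableI; first exact: (measurable_avoid PPZ).
by rewrite -[X in measurable X]setTI; exact: mZ.
Qed.

Definition hit_before (N : nat) f (w : Omega) : \bar R :=
  \sum_(n < N) ((fun w => (f (Z n w))%:E) \_ (hit_at n)) w.

Lemma hit_before_cvg f w : hit_before N f w @[N --> \oo] --> (hit_value f w)%:E.
Proof.
rewrite /hit_value; have := hitting_time_spec w.
case: (hitting_time Z V w) => [n hn|hN].
  apply: cvg_near_cst; exists n.+1 => // N /= nN.
  rewrite /hit_before (bigD1 (Ordinal nN))//= patchE mem_set// big1 ?adde0// => i.
  move=> /eqP ine; rewrite patchE memNset// => hi; apply: ine.
  by apply/val_inj => /=; exact: hit_at_inj hi hn.
apply: cvg_near_cst; exists 0%N => // N _.
by rewrite /hit_before big1// => i _; rewrite patchE memNset.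
Qed.

Section nonneg.
Variable f : M -> R.
Hypothesis mf : measurable_fun [set: M] f.
Hypothesis f0 : forall x, (0 <= f x)%R.

Let term_ge0 n w : 0 <= ((fun w => (f (Z n w))%:E) \_ (hit_at n)) w.
Proof. by apply: erestrict_ge0 => y _; rewrite lee_fin. Qed.

Let mterm n : measurable_fun [set: Omega] ((fun w => (f (Z n w))%:E) \_ (hit_at n)).
Proof.
apply/(measurable_restrictT _ _).1; first exact: measurable_hit_at.
by apply: measurable_funTS; apply/measurable_EFinP; exact: measurableT_comp.
Qed.

Lemma hit_before_nd w : {homo hit_before ^~ f ^~ w : m n / (m <= n)%N >-> m <= n}.
Proof.
apply/nondecreasing_seqP => n; rewrite /hit_before big_ord_recr/= leeDl//.
Qed.

Lemma measurable_hit_value : measurable_fun [set: Omega] (hit_value f).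
Proof.
apply/measurable_EFinP; apply: (emeasurable_fun_cvg (hit_before ^~ f)).
  by move=> N; exact: emeasurable_sum.
by move=> w _; exact: hit_before_cvg.
Qed.

Lemma hit_value_ge0 w : (0 <= hit_value f w)%R.
Proof. by rewrite /hit_value; case: (hitting_time Z V w). Qed.

Definition hit_mean (x : M) : \bar R := \int[PP x]_w (hit_value f w)%:E.

Lemma hit_mean_ge0 x : 0 <= hit_mean x.
Proof. by apply: integral_ge0 => w _; rewrite lee_fin hit_value_ge0. Qed.

Let h : M -> \bar R := (EFin \o f) \_ V.
Let h0 x : 0 <= h x.
Proof. by apply: erestrict_ge0 => y _; rewrite lee_fin. Qed.
Let mh : measurable_fun [set: M] h.
Proof.
apply/(measurable_restrictT _ _).1 => //.
by apply: measurable_funTS; exact/measurable_EFinP.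
Qed.

(** Term n is the contribution of the paths that first reach [V] at time n. Through this series only
    the one-step Markov property is used. *)
Let G N x := \sum_(n < N) iter n killedV h x.

Let G_ge0 N x : 0 <= G N x.
Proof. by apply: sume_ge0 => n _; case: (iter_killed P mV n h0 mh). Qed.

Let mG N : measurable_fun [set: M] (G N).
Proof. by apply: emeasurable_sum => n; case: (iter_killed P mV n h0 mh). Qed.

Let G_nd x : {homo G ^~ x : m n / (m <= n)%N >-> m <= n}.
Proof.
apply/nondecreasing_seqP => n; rewrite /G big_ord_recr/= leeDl//.
by case: (iter_killed P mV n h0 mh).
Qed.

Let integral_hit_before N x : \int[PP x]_w hit_before N f w = G N x.
Proof.
rewrite ge0_integral_sum//; apply: eq_bigr => n _.
rewrite -integral_mkcond /hit_at integral_mkcondr.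
by rewrite -(integral_avoid PPZ mV x n h0 mh).
Qed.

Let hit_mean_cvg x : G N x @[N --> \oo] --> hit_mean x.
Proof.
under eq_fun do rewrite -integral_hit_before.
apply: monotone_cvg_integral.
- by move=> N; exact: emeasurable_sum.
- by move=> N w; exact: sume_ge0.
- by move=> w; exact: hit_before_nd.
- by move=> w; exact: hit_before_cvg.
Qed.

(** The terms of the series are iterates of the kernel, so measurability in the starting point comes
    from [P]. *)
Lemma measurable_hit_mean : measurable_fun [set: M] hit_mean.
Proof. by apply: (emeasurable_fun_cvg G) => // x _; exact: hit_mean_cvg. Qed.

(** First-step analysis read off the series: removing the term n = 0 from [G N.+1] leaves the killed
    kernel applied to [G N], and monotone convergence passes to the limit. *)
Lemma hit_mean_recE x : hit_mean x = h x + killedV hit_mean x.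
Proof.
have GS N : G N.+1 x = h x + killedV (G N) x.
  rewrite /G big_ord_recl/=; congr (_ + _).
  rewrite /killed patchE; case: ifPn => xV.
    rewrite ge0_integral_sum// => [|n|n y _].
    - by apply: eq_bigr => n _; rewrite /killed patchE xV.
    - by case: (iter_killed P mV n h0 mh).
    - by case: (iter_killed P mV n h0 mh).
  by rewrite big1// => n _; rewrite /killed patchE (negPf xV).
have : G N.+1 x @[N --> \oo] --> hit_mean x.
  by rewrite (cvg_shiftS (fun N => G N x)); exact: hit_mean_cvg.
under eq_fun do rewrite GS.
move=> cvg1; apply: (cvg_unique _ cvg1) => //.
apply: cvgeD; last 2 first.
- exact: cvg_cst.
- rewrite /killed patchE; case: ifPn => xV; last first.
    by under eq_fun do rewrite patchE (negPf xV); exact: cvg_cst.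
  under eq_fun do rewrite patchE xV.
  by apply: monotone_cvg_integral.
by apply: ge0_adde_def; rewrite inE//; apply: killed_ge0; exact: hit_mean_ge0.
Qed.

Lemma hit_mean_in x : V x -> hit_mean x = (f x)%:E.
Proof.
by move=> Vx; rewrite hit_mean_recE /h /killed !patchE mem_set// memNset ?adde0//.
Qed.

Lemma hit_mean_out x : ~ V x -> hit_mean x = \int[P x]_y hit_mean y.
Proof.
by move=> Vx; rewrite hit_mean_recE /h /killed !patchE memNset// mem_set// add0e.
Qed.

End nonneg.

Lemma hit_value_le f g w : (forall x, f x <= g x)%R -> (hit_value f w <= hit_value g w)%R.
Proof. by move=> fg; rewrite /hit_value; case: (hitting_time Z V w). Qed.

Lemma le_hit_mean f g x : measurable_fun [set: M] f -> measurable_fun [set: M] g ->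
  (forall x, 0 <= f x)%R -> (forall x, f x <= g x)%R -> hit_mean f x <= hit_mean g x.
Proof.
move=> mf mg f0 fg; apply: ge0_le_integral => //.
- by move=> w _; rewrite lee_fin hit_value_ge0.
- by apply/measurable_EFinP; exact: measurable_hit_value.
- by apply/measurable_EFinP; exact: measurable_hit_value.
- by move=> w _; rewrite lee_fin hit_value_le.
Qed.

Lemma hit_mean_bound f (C : R) x : measurable_fun [set: M] f ->
  (forall x, 0 <= f x <= C)%R -> hit_mean f x <= C%:E.
Proof.
move=> mf fC; have C0 : (0 <= C)%R by case/andP: (fC x); exact: le_trans.
apply: (@le_trans _ _ (\int[PP x]_w (C%:E))).
  apply: ge0_le_integral => //.
  - by move=> w _; rewrite lee_fin hit_value_ge0// => y; case/andP: (fC y).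
  - by apply/measurable_EFinP; exact: measurable_hit_value.
  - move=> w _; rewrite lee_fin /hit_value; case: (hitting_time Z V w) => [n|//].
    by case/andP: (fC (Z n w)).
rewrite integral_cst// -[leRHS]mule1 le_eqVlt; apply/orP; left; apply/eqP.
by congr (_ * _); exact: probability_setT.
Qed.

Lemma hit_mean_monotone (f_ : nat -> M -> R) f x :
  (forall n, measurable_fun [set: M] (f_ n)) -> (forall n y, 0 <= f_ n y)%R ->
  (forall y, {homo f_ ^~ y : m n / (m <= n)%N >-> (m <= n)%R}) ->
  (forall y, f_ n y @[n --> \oo] --> f y) ->
  hit_mean (f_ n) x @[n --> \oo] --> hit_mean f x.
Proof.
move=> mf f0 nd cv.
apply: monotone_cvg_integral.
- by move=> n; apply/measurable_EFinP; exact: measurable_hit_value.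
- by move=> n w; rewrite lee_fin hit_value_ge0.
- by move=> w m n mn; rewrite lee_fin; apply: hit_value_le => y; exact: nd.
- move=> w; apply: cvg_EFin; first exact: nearW.
  by rewrite /hit_value; case: (hitting_time Z V w) => [n|]; [exact: cv|exact: cvg_cst].
Qed.

Lemma hitting_extensionE f x : measurable_fun [set: M] f ->
  hitting_extension PP Z V f x =
  fine (hit_mean (f^\+)%R x - hit_mean (f^\-)%R x).
Proof.
move=> mf; rewrite /hitting_extension /Rintegral; congr fine.
rewrite integralE; congr (_ - _); apply: eq_integral => w _.
  rewrite funerpos /= /hit_value /funrpos; congr EFin.
  by case: (hitting_time Z V w) => //; rewrite maxxx.
rewrite funerneg /= /hit_value /funrneg; congr EFin.
by case: (hitting_time Z V w) => //; rewrite oppr0 maxxx.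
Qed.

End hitting_value.

(** * Integrals over V, normalized and unnormalized *)

Section normalized_restriction.
Context d (R : realType) (M : measurableType d) (mu : probability M R).
Variables (V : set M) (mV : measurable V).
Hypothesis V0 : (0 < mu V)%E.
Local Notation nu := (steklov_nu mu mV).
Local Notation c := (fine (mu V)).

Let c_gt0 : 0 < c.
Proof. by rewrite fine_gt0// V0 ltey_eq fin_num_measure. Qed.

Lemma restr_fin : (mrestr mu mV setT < +oo)%E.
Proof. by rewrite /mrestr setTI -ge0_fin_numE// fin_num_measure. Qed.

Lemma steklov_nuE A : nu A = (mrestr mu mV A * (c^-1)%:E)%E.
Proof.
rewrite /steklov_nu /= /mnormalize /= {1 2}/mrestr setTI gt_eqF//=.
rewrite (_ : (mu V == +oo)%E = false); last first.
  by apply/negbTE; rewrite -ltey ltey_eq fin_num_measure.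
by rewrite /mrestr setTI.
Qed.

Lemma ge0_integral_nu (g : M -> \bar R) : measurable_fun [set: M] g ->
  (forall x, 0 <= g x)%E -> (\int[nu]_x g x = (c^-1)%:E * \int[mrestr mu mV]_x g x)%E.
Proof.
move=> mg g0; have c0 : 0 <= c^-1 by rewrite invr_ge0 ltW.
rewrite (@eq_measure_integral _ _ _ _ (mscale (NngNum c0) (mrestr mu mV))).
  by rewrite ge0_integral_mscale.
by move=> A mA _; apply: etrans (steklov_nuE A) _; rewrite /mscale /= muleC.
Qed.

Lemma Rint_nu (g : M -> R) : bmeas g ->
  \int[mrestr mu mV]_x g x = c * \int[nu]_x g x.
Proof.
have pos (h : M -> R) : bmeas h -> (forall x, 0 <= h x) ->
    \int[mrestr mu mV]_x h x = c * \int[nu]_x h x.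
  move=> bh h0; have mh : measurable_fun [set: M] (EFin \o h).
    by apply/measurable_EFinP; case: bh.
  rewrite {2}/Rintegral ge0_integral_nu// -(EFin_Rint restr_fin)// -EFinM /=.
  by rewrite mulrA divff ?mul1r// gt_eqF.
move=> bg; have [_ [D hD]] := bg.
have bD : bmeas (fun _ : M => D : R) by exact: bmeas_cst.
have := pos (fun x => g x + D) (bmeasD bg bD).
rewrite (RintD restr_fin)// (RintD (prob_fin nu))// !Rintegral_cst//.
rewrite [fine (nu _)](_ : _ = 1); last exact: (congr1 fine (probability_setT nu)).
rewrite [fine (mrestr _ _ _)](_ : _ = c); last by rewrite /mrestr setTI.
move=> H; have : forall x, 0 <= g x + D.
  by move=> x; have := hD x; rewrite ler_norml => /andP[]; lra.
move=> /H; lra.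
Qed.

Lemma Rint_restr (g : M -> R) : bmeas g ->
  \int[mrestr mu mV]_x g x = \int[mu]_x (\1_V x * g x).
Proof.
have bV := bmeas_indic R mV.
have pos (h : M -> R) : bmeas h -> (forall x, 0 <= h x) ->
    \int[mrestr mu mV]_x h x = \int[mu]_x (\1_V x * h x).
  move=> bh h0; rewrite /Rintegral ge0_integral_mrestr//; last first.
    by apply/measurable_EFinP; case: bh.
  congr fine; rewrite integral_mkcond; apply: eq_integral => x _.
  by rewrite patchE indicE; case: (x \in V); rewrite ?mul1r ?mul0r.
move=> bg; have [_ [D hD]] := bg.
have bD : bmeas (fun _ : M => D : R) by exact: bmeas_cst.
have := pos (fun x => g x + D) (bmeasD bg bD).
rewrite (RintD restr_fin)//.
have gD x : 0 <= g x + D.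
  by have := hD x; rewrite ler_norml => /andP[]; lra.
move=> /(_ gD).
have -> : \int[mu]_x (\1_V x * (g x + D)) = \int[mu]_x (\1_V x * g x + \1_V x * D).
  by apply: eq_Rintegral => x _; rewrite mulrDr.
rewrite (RintD (prob_fin mu)); [|exact: bmeasM|exact: bmeasM].
have -> : \int[mrestr mu mV]_x D = \int[mu]_x (\1_V x * D).
  under [RHS]eq_Rintegral do rewrite mulrC.
  have rE : mrestr mu mV setT = mu V by rewrite /mrestr setTI.
  rewrite (RintZ (prob_fin mu))// Rint_indic// Rintegral_cst//; congr (_ * _).
  exact: (congr1 fine rE).
by move/addIr.
Qed.

End normalized_restriction.

(** * Energy of the extension of a bounded function *)

Section energy.
Context d dO (R : realType) (M : measurableType d) (Omega : measurableType dO).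
Variables (mu : probability M R) (P : R.-pker M ~> M).
Variables (PP : M -> probability Omega R).
Variables (Z : nat -> Omega -> M) (PPZ : is_markov_chain P PP Z).
Variables (V : set M) (mV : measurable V).
Hypothesis Prev : reversible mu P.
Local Notation J := (edge_int mu P).
Local Notation F := (hitting_extension PP Z V).
Local Notation K := (steklov_kernel P PP Z V).
Local Notation hm := (hit_mean PP Z V).

Let bmeas1 (f : M -> R) : bmeas f -> bmeas (fun z : M * M => f z.1).
Proof. by apply: bmeas_comp; exact: measurable_fst. Qed.
Let bmeas2 (f : M -> R) : bmeas f -> bmeas (fun z : M * M => f z.2).
Proof. by apply: bmeas_comp; exact: measurable_snd. Qed.

Lemma bmeas_funrpos (f : M -> R) : bmeas f -> bmeas f^\+.
Proof.
move=> [mf [C fC]]; split; first exact: measurable_funrpos.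
exists C => x; rewrite ger0_norm ?funrpos_ge0// /funrpos ge_max.
by rewrite (le_trans (ler_norm _) (fC x)) (le_trans _ (fC x)).
Qed.

Lemma bmeas_funrneg (f : M -> R) : bmeas f -> bmeas f^\-.
Proof. by move=> bf; rewrite -funrposN; apply: bmeas_funrpos; exact: bmeasN. Qed.

Lemma fine_hit_mean (f : M -> R) : bmeas f -> (forall x, 0 <= f x) ->
  [/\ forall x, hm f x \is a fin_num, bmeas (fun x => fine (hm f x)),
      forall x, V x -> fine (hm f x) = f x &
      forall x, ~ V x -> fine (hm f x) = \int[P x]_y fine (hm f y)].
Proof.
move=> bf f0; have [mf [C fC]] := bf.
have hmC x : (hm f x <= C%:E)%E.
  apply: (hit_mean_bound PPZ mV) => // y.
  by rewrite f0/= (le_trans (ler_norm _) (fC y)).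
have hm0 x : (0 <= hm f x)%E by exact: hit_mean_ge0.
have fin x : hm f x \is a fin_num.
  by rewrite ge0_fin_numE// (le_lt_trans (hmC x))// ltry.
split=> //.
- split; first by apply: measurableT_comp => //; exact: (measurable_hit_mean PPZ mV).
  exists C => x; rewrite ger0_norm ?fine_ge0//.
  by rewrite -lee_fin fineK.
- by move=> x Vx; rewrite (hit_mean_in PPZ mV).
- move=> x Vx; rewrite (hit_mean_out PPZ mV mf f0 Vx) /Rintegral; congr fine.
  by apply: eq_integral => y _; rewrite fineK.
Qed.

Lemma hitting_extension_bmeas (f : M -> R) : bmeas f ->
  [/\ F f = (fun x => fine (hm f^\+ x) - fine (hm f^\- x)), bmeas (F f),
      forall x, V x -> F f x = f x & forall x, ~ V x -> F f x = K f x].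
Proof.
move=> bf; have mf := bmeas_measurable bf.
have [fin1 b1 in1 out1] := fine_hit_mean (bmeas_funrpos bf) (funrpos_ge0 f).
have [fin2 b2 in2 out2] := fine_hit_mean (bmeas_funrneg bf) (funrneg_ge0 f).
have FE : F f = (fun x => fine (hm f^\+ x) - fine (hm f^\- x)).
  by apply/funext => x; rewrite hitting_extensionE// fineB.
split=> //.
- by rewrite FE; exact: bmeasB.
- move=> x Vx; rewrite FE in1// in2//.
  by have /(congr1 (fun h => h x)) := funrposBneg f; rewrite fctE.
- move=> x Vx; rewrite {1}FE out1// out2// -(RintB (pker_fin P x))//.
  by rewrite /steklov_kernel FE.
Qed.

Lemma bmeas_steklov_kernel (f : M -> R) : bmeas f -> bmeas (K f).
Proof.
move=> bf; have [_ bF _ _] := hitting_extension_bmeas bf.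
exact: (bmeas_kernel_Rint P (bmeas2 bF)).
Qed.

(* Off V the extension is P-harmonic, so only V contributes. *)
Lemma energy_identity (f : M -> R) : bmeas f ->
  J (fun z => (F f z.1 - F f z.2) ^+ 2) =
  2 * \int[mrestr mu mV]_x (f x * (f x - K f x)).
Proof.
move=> bf; have [_ bF Fin Fout] := hitting_extension_bmeas bf.
have bK := bmeas_steklov_kernel bf.
have bF2 : bmeas (fun x => F f x ^+ 2) by exact: bmeasX.
have bFK : bmeas (fun x => F f x * K f x) by exact: bmeasM.
have bFF : bmeas (fun z : M * M => F f z.1 * F f z.2).
  by apply: bmeasM; [exact: bmeas1|exact: bmeas2].
have -> : (fun z : M * M => (F f z.1 - F f z.2) ^+ 2) =
    (fun z => (F f z.1 ^+ 2 + F f z.2 ^+ 2) - 2 * (F f z.1 * F f z.2)).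
  by apply/funext => z; ring.
rewrite edge_intB; last 2 first.
- by apply: bmeasD; [exact: (bmeas1 bF2)|exact: (bmeas2 bF2)].
- by apply: bmeasM => //; exact: bmeas_cst.
rewrite (edge_intD mu P (bmeas1 bF2) (bmeas2 bF2)) edge_intZ//.
rewrite (edge_int_fst mu P bF2) (edge_int_snd Prev bF2).
have -> : J (fun z => F f z.1 * F f z.2) = \int[mu]_x (F f x * K f x).
  by apply: eq_Rintegral => x _; rewrite /= (RintZ (pker_fin P x)).
rewrite Rint_restr//; last by apply: bmeasM => //; exact: bmeasB.
have -> : \int[mu]_x (\1_V x * (f x * (f x - K f x))) =
    \int[mu]_x (F f x ^+ 2 - F f x * K f x).
  apply: eq_Rintegral => x _; rewrite indicE.
  have [Vx|Vx] := pselect (V x); first by rewrite mem_set// Fin//=; ring.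
  by rewrite memNset// Fout//=; ring.
rewrite (RintB (prob_fin mu))//; ring.
Qed.

End energy.

(** * The quadratic form of the Steklov kernel on L^2 *)

Section clipping.
Context d (R : realType) (M : measurableType d).
Implicit Types f g : M -> R.

Definition trunc (n : nat) g : M -> R := fun x => Num.min (g x) n%:R.
(** The projection of f(x) onto [-n, n]. Writing it by parts makes its positive and negative parts
    the truncations of those of f, which increase with n, so that monotone convergence applies to
    each. *)
Definition clip (n : nat) f : M -> R := fun x => trunc n f^\+ x - trunc n f^\- x.

Lemma trunc_ge0 n g x : (forall x, 0 <= g x) -> 0 <= trunc n g x.
Proof. by move=> g0; rewrite le_min g0 ler0n. Qed.

Lemma trunc_le n g x : trunc n g x <= g x.
Proof. by rewrite ge_min lexx. Qed.

Lemma trunc_nd g x : {homo trunc ^~ g ^~ x : m n / (m <= n)%N >-> m <= n}.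
Proof. by move=> m n mn; rewrite le_min !ge_min lexx ler_nat mn orbT. Qed.

Lemma trunc_cvg g x : trunc n g x @[n --> \oo] --> g x.
Proof.
apply: cvg_near_cst; exists (Num.truncn (g x)).+1 => // n /= gn.
apply/min_idPl; rewrite (le_trans (ltW (truncnS_gt (g x))))// ler_nat//.
Qed.

Lemma bmeas_trunc n g : measurable_fun [set: M] g -> (forall x, 0 <= g x) ->
  bmeas (trunc n g).
Proof.
move=> mg g0; split; first exact: measurable_minr.
by exists n%:R => x; rewrite ger0_norm ?trunc_ge0// ge_min lexx orbT.
Qed.

Lemma clip_pos n f : (clip n f)^\+ = trunc n f^\+.
Proof.
apply/funext => x; rewrite /funrpos /clip /trunc /funrpos /funrneg.
have n0 : 0 <= n%:R :> R by [].
have [f0|f0] := leP (f x) 0.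
  rewrite (min_idPl n0) sub0r; apply/max_idPr.
  by rewrite oppr_le0 le_min n0 andbT le_max lexx orbT.
rewrite (max_idPr (_ : - f x <= 0)) ?oppr_le0 ?ltW// (min_idPl n0) subr0.
by apply/max_idPl; rewrite le_min n0 ltW.
Qed.

Lemma clipN n f : clip n (fun x => - f x) = (fun x => - clip n f x).
Proof.
apply/funext => x; rewrite /clip (_ : (fun x => - f x)^\+ = f^\-) ?funrposN//.
rewrite (_ : (fun x => - f x)^\- = f^\+) ?funrnegN// opprB//.
Qed.

Lemma clip_neg n f : (clip n f)^\- = trunc n f^\-.
Proof.
rewrite -funrposN -(funrposN f).
by rewrite (_ : (\- clip n f) = clip n (\- f)) ?clip_pos// clipN.
Qed.

Lemma clip_norm n f x : `|clip n f x| <= `|f x|.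
Proof.
have /(congr1 (fun h => h x)) := funrposDneg (clip n f).
have /(congr1 (fun h => h x)) := funrposDneg f.
rewrite !fctE/= => <- <-; rewrite clip_pos clip_neg.
by rewrite lerD ?trunc_le.
Qed.

Lemma clip_cvg f x : clip n f x @[n --> \oo] --> f x.
Proof.
have /(congr1 (fun h => h x)) := funrposBneg f; rewrite fctE => <-.
by apply: cvgB; exact: trunc_cvg.
Qed.

Lemma bmeas_clip n f : measurable_fun [set: M] f -> bmeas (clip n f).
Proof.
move=> mf; apply: bmeasB.
  by apply: bmeas_trunc; [exact: measurable_funrpos|exact: funrpos_ge0].
by apply: bmeas_trunc; [exact: measurable_funrneg|exact: funrneg_ge0].
Qed.

Lemma cvg_Rint_clipM (m : {measure set M -> \bar R}) f g :
  measurable_fun [set: M] f -> measurable_fun [set: M] g ->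
  m.-integrable [set: M] (EFin \o (f \* g)) ->
  \int[m]_x (clip n f x * clip n g x) @[n --> \oo] --> \int[m]_x (f x * g x).
Proof.
move=> mf mg ifg.
have [|||||_ _ H] := @dominated_convergence _ _ _ m setT measurableT
  (fun n x => (clip n f x * clip n g x)%:E) (fun x => (f x * g x)%:E)
  (fun x => `|(f x * g x)%:E|%E).
- move=> n; apply/measurable_EFinP; apply: measurable_funM;
    by apply: bmeas_measurable; exact: bmeas_clip.
- by apply/measurable_EFinP; exact: measurable_funM.
- apply: aeW => x _; apply: cvg_EFin; first exact: nearW.
  by apply: cvgM; exact: clip_cvg.
- exact: integrable_abse.
- apply: aeW => x n _; rewrite /= lee_fin !normrM.
  by rewrite ler_pM// clip_norm.
by apply: fine_cvg; rewrite fineK//; exact: integrable_fin_num.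
Qed.

End clipping.

Lemma dist_le_bound (R : realDomainType) (p q l : R) :
  0 <= p <= l -> 0 <= q <= l -> `|p - q| <= l + l.
Proof.
by move=> /andP[? ?] /andP[? ?]; rewrite ler_norml; apply/andP; split; lra.
Qed.

Section energy_limit.
Context d dO (R : realType) (M : measurableType d) (Omega : measurableType dO).
Variables (mu : probability M R) (P : R.-pker M ~> M).
Variables (PP : M -> probability Omega R).
Variables (Z : nat -> Omega -> M) (PPZ : is_markov_chain P PP Z).
Variables (V : set M) (mV : measurable V).
Hypothesis V0 : (0 < mu V)%E.
Hypothesis Prev : reversible mu P.
Local Notation nu := (steklov_nu mu mV).
Local Notation F := (hitting_extension PP Z V).
Local Notation K := (steklov_kernel P PP Z V).
Local Notation hm := (hit_mean PP Z V).

Implicit Types f g : M -> R.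

(** The Steklov kernel on nonnegative functions with values in [0, +oo]: monotone, compatible with
    increasing limits, and free of the default values of real integrals. *)
Definition Kbar (g : M -> R) (x : M) : \bar R := (\int[P x]_y hm g y)%E.

Lemma Kbar_ge0 g x : (forall x, 0 <= g x) -> (0 <= Kbar g x)%E.
Proof. by move=> g0; apply: integral_ge0 => y _; exact: hit_mean_ge0. Qed.

Lemma measurable_Kbar g : measurable_fun [set: M] g -> (forall x, 0 <= g x) ->
  measurable_fun [set: M] (Kbar g).
Proof.
move=> mg g0; apply: measurable_kernel_integral => [x|].
  exact: hit_mean_ge0.
exact: (measurable_hit_mean PPZ mV).
Qed.

Lemma le_Kbar f g x : measurable_fun [set: M] f -> measurable_fun [set: M] g ->
  (forall x, 0 <= f x) -> (forall x, f x <= g x) -> (Kbar f x <= Kbar g x)%E.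
Proof.
move=> mf mg f0 fg; have g0 y : 0 <= g y by exact: le_trans (f0 y) (fg y).
apply: ge0_le_integral => //.
- by move=> y _; exact: hit_mean_ge0.
- exact: (measurable_hit_mean PPZ mV).
- exact: (measurable_hit_mean PPZ mV).
- by move=> y _; exact: (le_hit_mean PPZ mV).
Qed.

Lemma Kbar_fin g x : bmeas g -> (forall x, 0 <= g x) -> Kbar g x \is a fin_num.
Proof.
move=> bg g0; have [fin b _ _] := fine_hit_mean PPZ mV bg g0.
have -> : Kbar g x = (\int[P x]_y (fine (hm g y))%:E)%E.
  by apply: eq_integral => y _; rewrite fineK.
by rewrite -(EFin_Rint (pker_fin P x))// => y; rewrite fine_ge0// hit_mean_ge0.
Qed.

Lemma Kbar_trunc_cvg g x : measurable_fun [set: M] g -> (forall x, 0 <= g x) ->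
  Kbar (trunc n g) x @[n --> \oo] --> Kbar g x.
Proof.
move=> mg g0.
have mt n : measurable_fun [set: M] (trunc n g) by case: (bmeas_trunc n mg g0).
apply: monotone_cvg_integral => [n|n y|y i j ij|y].
- by apply: (measurable_hit_mean PPZ mV) => // y; exact: trunc_ge0.
- by apply: hit_mean_ge0 => z; exact: trunc_ge0.
- apply: (le_hit_mean PPZ mV) => // z; first exact: trunc_ge0.
  exact: trunc_nd.
- apply: (hit_mean_monotone PPZ mV) => //.
  + by move=> n z; exact: trunc_ge0.
  + by move=> z; exact: trunc_nd.
  + by move=> z; exact: trunc_cvg.
Qed.

Lemma measurable_hitting_extension f : measurable_fun [set: M] f ->
  measurable_fun [set: M] (F f).
Proof.
move=> mf; rewrite (_ : F f = fine \o (fun x => hm f^\+%R x - hm f^\-%R x)%E); last first.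
  by apply/funext => x; rewrite hitting_extensionE.
apply: measurableT_comp => //; apply: emeasurable_funB.
  by apply: (measurable_hit_mean PPZ mV); [exact: measurable_funrpos|exact: funrpos_ge0].
by apply: (measurable_hit_mean PPZ mV); [exact: measurable_funrneg|exact: funrneg_ge0].
Qed.

Lemma measurable_steklov_kernel f : measurable_fun [set: M] f ->
  measurable_fun [set: M] (K f).
Proof.
move=> mf; have mF : measurable_fun [set: M] (EFin \o F f).
  by apply/measurable_EFinP; exact: measurable_hitting_extension.
rewrite (_ : K f = fine \o (fun x => \int[P x]_y (EFin \o F f)^\+%E y -
    \int[P x]_y (EFin \o F f)^\-%E y)%E); last first.
  by apply/funext => x; rewrite /steklov_kernel /Rintegral integralE.
apply: measurableT_comp => //; apply: emeasurable_funB.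
  by apply: measurable_kernel_integral => //; exact: measurable_funepos.
by apply: measurable_kernel_integral => //; exact: measurable_funeneg.
Qed.

(** Finiteness at [x] makes both hitting means finite for P x-almost every y, and there the
    extension is a genuine difference. *)
Lemma steklov_kernelE f x : measurable_fun [set: M] f ->
  Kbar f^\+ x \is a fin_num -> Kbar f^\- x \is a fin_num ->
  K f x = fine (Kbar f^\+ x) - fine (Kbar f^\- x).
Proof.
move=> mf finp finn.
have mp := measurable_funrpos mf; have mn := measurable_funrneg mf.
have int g : measurable_fun [set: M] g -> (forall x, 0 <= g x) ->
    Kbar g x \is a fin_num -> (P x).-integrable setT (hm g).
  move=> mg g0 fin; apply/integrableP; split.
    exact: (measurable_hit_mean PPZ mV).
  under eq_integral do rewrite gee0_abs ?hit_mean_ge0//.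
  by rewrite -ge0_fin_numE// Kbar_ge0.
have ip := int _ mp (funrpos_ge0 f) finp.
have iN := int _ mn (funrneg_ge0 f) finn.
rewrite -(fineB finp finn) /Kbar -(integralB measurableT ip iN); congr fine.
apply: ae_eq_integral => //.
- by apply/measurable_EFinP; exact: measurable_hitting_extension.
- by apply: emeasurable_funB; exact: (measurable_hit_mean PPZ mV).
have := integrable_ae measurableT ip; have := integrable_ae measurableT iN.
apply: filterS2 => y /(_ I) fn /(_ I) fp _.
by rewrite hitting_extensionE// fineK// fin_numB fp fn.
Qed.

Lemma Kbar0 x : Kbar (fun=> 0) x = 0%E.
Proof.
rewrite /Kbar /hit_mean integral0_eq// => y _; rewrite integral0_eq// => w _.
by rewrite /hit_value; case: (hitting_time Z V w).
Qed.

Local Opaque Kbar.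

Lemma steklov_kernel_bmeasE f x : bmeas f ->
  [/\ Kbar f^\+ x \is a fin_num, Kbar f^\- x \is a fin_num &
      K f x = fine (Kbar f^\+ x) - fine (Kbar f^\- x)].
Proof.
move=> bf; have fp := Kbar_fin x (bmeas_funrpos bf) (funrpos_ge0 f).
have fn := Kbar_fin x (bmeas_funrneg bf) (funrneg_ge0 f).
by split=> //; apply: steklov_kernelE => //; case: bf.
Qed.

(** Up to a positive factor, the difference of the two sides is the energy of the extension of [g],
    hence nonnegative. *)
Lemma Kbar_form_bmeas g : bmeas g -> (forall x, 0 <= g x) ->
  (\int[nu]_x ((g x)%:E * Kbar g x) <= \int[nu]_x (g x ^+ 2)%:E)%E.
Proof.
move=> bg g0; have bK := bmeas_steklov_kernel PPZ mV bg.
have KE x : (K g x)%:E = Kbar g x.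
  have [_ _ ->] := steklov_kernel_bmeasE x bg.
  have gp : g^\+ = g by apply/funext => y; apply/max_idPl.
  have gn : g^\- = fun=> 0 by apply/funext => y; apply/max_idPr; rewrite oppr_le0.
  by rewrite gn Kbar0 subr0 gp; exact: fineK (Kbar_fin x bg g0).
have b2 : bmeas (fun x => g x ^+ 2) by exact: bmeasX.
have b1 : bmeas (fun x => g x * K g x) by exact: bmeasM.
under eq_integral do rewrite -KE -EFinM.
rewrite -(EFin_Rint (prob_fin nu))//; last first.
  by move=> x; rewrite mulr_ge0// -lee_fin KE Kbar_ge0.
rewrite -(EFin_Rint (prob_fin nu))//; last by move=> x; exact: sqr_ge0.
rewrite lee_fin.
have c0 : 0 < fine (mu V) by rewrite fine_gt0// V0 ltey_eq fin_num_measure.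
have := energy_identity PPZ mV Prev bg.
have -> : \int[mrestr mu mV]_x (g x * (g x - K g x)) =
    \int[mrestr mu mV]_x (g x ^+ 2 - g x * K g x).
  by apply: eq_Rintegral => x _; ring.
rewrite Rint_nu//; last exact: bmeasB.
rewrite (RintB (prob_fin nu))// => E.
have : 0 <= 2 * (fine (mu V) * (\int[nu]_x g x ^+ 2 - \int[nu]_x (g x * K g x))).
  by rewrite -E; apply: edge_int_ge0 => z; exact: sqr_ge0.
by rewrite pmulr_rge0// pmulr_rge0// subr_ge0.
Qed.

Lemma Kbar_form g : measurable_fun [set: M] g -> (forall x, 0 <= g x) ->
  (\int[nu]_x ((g x)%:E * Kbar g x) <= \int[nu]_x (g x ^+ 2)%:E)%E.
Proof.
move=> mg g0.
have bt n := bmeas_trunc n mg g0; have mt n := bmeas_measurable (bt n).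
have t0 n x : 0 <= trunc n g x by exact: trunc_ge0.
have cv : (\int[nu]_x ((trunc n g x)%:E * Kbar (trunc n g) x))%E @[n --> \oo] -->
    (\int[nu]_x ((g x)%:E * Kbar g x))%E.
  apply: monotone_cvg_integral => [n|n x|x i j ij|x].
  - apply: emeasurable_funM; first by apply/measurable_EFinP.
    exact: measurable_Kbar.
  - by rewrite mule_ge0 ?lee_fin ?Kbar_ge0.
  - apply: lee_pmul; rewrite ?lee_fin ?Kbar_ge0//; first exact: trunc_nd.
    by apply: le_Kbar => // y; exact: trunc_nd.
  (* Where [g] vanishes, [Kbar g] may be +oo and the product is not continuous; every term is 0
     there. *)
  - have [g0x|g0x] := eqVneq (g x) 0.
      have E n : trunc n g x = 0 by rewrite /trunc g0x; apply/min_idPl.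
      under eq_fun do rewrite E mul0e.
      by rewrite g0x mul0e; exact: cvg_cst.
    apply: cvgeM; last exact: Kbar_trunc_cvg.
      by rewrite /mule_def; case: (Kbar g x).
    by apply: cvg_EFin; [exact: nearW|exact: trunc_cvg].
apply: (cvge_le _ cv); apply: nearW => n.
apply: le_trans (Kbar_form_bmeas (bt n) (t0 n)) _.
apply: ge0_le_integral => //.
- by move=> x _; rewrite lee_fin sqr_ge0.
- by apply/measurable_EFinP; exact: measurable_funX.
- by apply/measurable_EFinP; exact: measurable_funX.
- by move=> x _; rewrite lee_fin ler_pXn2r ?nnegrE ?trunc_le.
Qed.

(** Dominated convergence needs control of |f| K|f| only, not of K f in L^2, and [Kbar_form] applied
    to |f| provides it. *)
Lemma energy_limit f : measurable_fun [set: M] f ->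
  nu.-integrable [set: M] (EFin \o (fun x => f x ^+ 2)) ->
  \int[nu]_x (clip n f x * (clip n f x - K (clip n f) x)) @[n --> \oo] -->
  \int[nu]_x (f x * (f x - K f x)).
Proof.
move=> mf if2; have [g gE] : exists g, g = (fun x => `|f x|) by eexists.
have gx_E x : g x = `|f x| by rewrite gE.
have mg : measurable_fun [set: M] g by rewrite gE; exact: measurableT_comp.
have g0 x : 0 <= g x by rewrite gx_E.
have mp := measurable_funrpos mf; have mn := measurable_funrneg mf.
have igK : nu.-integrable [set: M] (fun x => (g x)%:E * Kbar g x)%E.
  apply/integrableP; split.
    by apply: emeasurable_funM; [exact/measurable_EFinP|exact: measurable_Kbar].
  under eq_integral do rewrite gee0_abs ?mule_ge0 ?lee_fin ?Kbar_ge0//.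
  apply: le_lt_trans (Kbar_form mg g0) _.
  case/integrableP: if2 => _; apply: le_lt_trans.
  rewrite le_eqVlt; apply/orP; left; apply/eqP; apply: eq_integral => x _.
  by rewrite /= ger0_norm ?sqr_ge0// gx_E real_normK// num_real.
(* Dominating function: a clipped function is at most |f|, and the images of its positive and
   negative parts each contribute at most [Kbar g]. *)
pose G x := ((f x ^+ 2)%:E + ((g x)%:E * Kbar g x + (g x)%:E * Kbar g x))%E.
have iG : nu.-integrable [set: M] G by apply: integrableD => //; exact: integrableD.
have pg y : f^\+ y <= g y by rewrite gx_E /funrpos ge_max ler_norm normr_ge0.
have ng y : f^\- y <= g y by rewrite gx_E /funrneg ge_max normr_ge0 andbT -normrN ler_norm.
have bc n := bmeas_clip n mf.
(* Where f does not vanish, finiteness of G bounds Kbar g. *)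
have Kg0 x : (0 <= Kbar g x)%E by exact: Kbar_ge0.
have Kp0 x : (0 <= Kbar f^\+%R x)%E by exact: (Kbar_ge0 x (funrpos_ge0 f)).
have Kn0 x : (0 <= Kbar f^\-%R x)%E by exact: (Kbar_ge0 x (funrneg_ge0 f)).
have Kp_le x : (Kbar f^\+%R x <= Kbar g x)%E by exact: (le_Kbar x mp mg (funrpos_ge0 f) pg).
have Kn_le x : (Kbar f^\-%R x <= Kbar g x)%E by exact: (le_Kbar x mn mg (funrneg_ge0 f) ng).
have good x : G x \is a fin_num -> f x != 0 -> Kbar g x \is a fin_num.
  move=> Gx fx; rewrite (ge0_fin_numE (Kg0 x)) ltey; apply/eqP => Ky.
  move: Gx; rewrite /G Ky gt0_muley ?lte_fin ?gx_E ?normr_gt0//.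
have goodp x : Kbar g x \is a fin_num -> Kbar f^\+ x \is a fin_num.
  rewrite (ge0_fin_numE (Kg0 x)) (ge0_fin_numE (Kp0 x)).
  exact: le_lt_trans (Kp_le x).
have goodn x : Kbar g x \is a fin_num -> Kbar f^\- x \is a fin_num.
  rewrite (ge0_fin_numE (Kg0 x)) (ge0_fin_numE (Kn0 x)).
  exact: le_lt_trans (Kn_le x).
have clip0 n x : f x = 0 -> clip n f x = 0.
  move=> fx; apply/normr0_eq0/eqP.
  by rewrite eq_le normr_ge0 andbT (le_trans (clip_norm n f x))// fx normr0.
have [|||||iq _ H] := @dominated_convergence _ _ _ nu setT measurableT
  (fun n x => (clip n f x * (clip n f x - K (clip n f) x))%:E)
  (fun x => (f x * (f x - K f x))%:E) G.
- move=> n; apply/measurable_EFinP; apply: bmeas_measurable.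
  by apply: bmeasM => //; apply: bmeasB => //; exact: (bmeas_steklov_kernel PPZ mV).
- apply/measurable_EFinP; apply: measurable_funM => //; apply: measurable_funB => //.
  exact: measurable_steklov_kernel.
- have := integrable_ae measurableT iG; apply: filterS => x /(_ I) Gx _.
  apply: cvg_EFin; first exact: nearW.
  have [fx|fx] := eqVneq (f x) 0.
    by under eq_fun do rewrite clip0// mul0r; rewrite fx mul0r; exact: cvg_cst.
  have gx := good x Gx fx; have px := goodp x gx; have nx := goodn x gx.
  apply: cvgM; first exact: clip_cvg.
  apply: cvgB; first exact: clip_cvg.
  rewrite (steklov_kernelE mf px nx).
  rewrite (_ : (fun n => _) = fun n => fine (Kbar (trunc n f^\+) x) -
      fine (Kbar (trunc n f^\-) x)); last first.
    apply/funext => n; have [_ _ ->] := steklov_kernel_bmeasE x (bc n).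
    by rewrite clip_pos clip_neg.
  apply: cvgB; apply: fine_cvg.
    by rewrite (fineK px); exact: (Kbar_trunc_cvg mp (funrpos_ge0 f)).
  by rewrite (fineK nx); exact: (Kbar_trunc_cvg mn (funrneg_ge0 f)).
- exact: iG.
- have := integrable_ae measurableT iG; apply: filterS => x /(_ I) Gx n _.
  have [fx|fx] := eqVneq (f x) 0.
    rewrite clip0// mul0r abse0 /G adde_ge0 ?lee_fin ?sqr_ge0//.
    by rewrite adde_ge0// mule_ge0 ?lee_fin ?Kg0.
  have gx := good x Gx fx; have [pn nn ->] := steklov_kernel_bmeasE x (bc n).
  have [l lE] : exists l, Kbar g x = l%:E by exists (fine (Kbar g x)); exact: esym (fineK gx).
  rewrite /G lE -!EFinM -!EFinD lee_fin normrM gx_E.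
  have cn := clip_norm n f x.
  have lp : 0 <= fine (Kbar (clip n f)^\+ x) <= l.
    rewrite -2!lee_fin (fineK pn) -lE (Kbar_ge0 x (funrpos_ge0 _)) /=.
    apply: (le_Kbar x (measurable_funrpos (bmeas_measurable (bc n))) mg (funrpos_ge0 _)).
    by move=> y; rewrite clip_pos; exact: le_trans (trunc_le _ _ _) (pg y).
  have ln : 0 <= fine (Kbar (clip n f)^\- x) <= l.
    rewrite -2!lee_fin (fineK nn) -lE (Kbar_ge0 x (funrneg_ge0 _)) /=.
    apply: (le_Kbar x (measurable_funrneg (bmeas_measurable (bc n))) mg (funrneg_ge0 _)).
    by move=> y; rewrite clip_neg; exact: le_trans (trunc_le _ _ _) (ng y).
  have h := le_trans (ler_normB _ _) (lerD cn (dist_le_bound lp ln)).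
  apply: le_trans (ler_pM (normr_ge0 _) (normr_ge0 _) cn h) _.
  by rewrite !mulrDr -[f x ^+ 2]real_normK ?num_real// expr2.
by apply: fine_cvg; rewrite fineK//; exact: integrable_fin_num.
Qed.

End energy_limit.

(** * Conclusion *)

Section gram.
Context d (R : realType) (M : measurableType d) (nu : probability M R).
Variables (k : nat) (b : 'I_k -> M -> R).
Hypothesis bL : forall i, b i \in Lfun nu 2%:E.
Hypothesis bfree : forall c : 'I_k -> R,
  {ae nu, forall x, \sum_(i < k) c i * b i x = 0} -> forall i, c i = 0.

Definition lin_comb (c : 'I_k -> R) : M -> R := fun x => \sum_(i < k) c i * b i x.

Lemma Lfun_lin_comb c : lin_comb c \in Lfun nu 2%:E.
Proof.
have one2 : (1 <= 2%:E :> \bar R)%E by rewrite lee_fin ler1n.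
rewrite /lin_comb; elim: (index_enum 'I_k) => [|i s IH].
  under eq_fun do rewrite big_nil.
  exact: (Lfun_submod_closed nu one2).1.
under eq_fun do rewrite big_cons.
exact: (Lfun_submod_closed nu one2).2 (c i) _ _ (bL i) IH.
Qed.

Lemma Lfun2_measurable (f : M -> R) : f \in Lfun nu 2%:E -> measurable_fun [set: M] f.
Proof. by rewrite inE => /andP[/[!inE]]. Qed.

Lemma Lfun2_mul_integrable (f g : M -> R) : f \in Lfun nu 2%:E -> g \in Lfun nu 2%:E ->
  nu.-integrable [set: M] (EFin \o (f \* g)).
Proof. by move=> fL gL; apply/Lfun1_integrable; exact: Lfun2_mul_Lfun1. Qed.

Lemma Rintegral_sum_integrable (I : Type) (s : seq I) (h : I -> M -> R) :
  (forall i, nu.-integrable [set: M] (EFin \o h i)) ->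
  nu.-integrable [set: M] (EFin \o (fun x => \sum_(i <- s) h i x)) /\
  \int[nu]_x (\sum_(i <- s) h i x) = \sum_(i <- s) \int[nu]_x h i x.
Proof.
move=> ih; elim: s => [|i s [IH1 IH2]].
  under [X in _.-integrable _ (EFin \o X)]eq_fun do rewrite big_nil.
  under eq_Rintegral do rewrite big_nil.
  rewrite big_nil Rintegral_cst// mul0r; split=> //; exact: integrable0.
under [X in _.-integrable _ (EFin \o X)]eq_fun do rewrite big_cons.
under eq_Rintegral do rewrite big_cons.
rewrite big_cons; split; last by rewrite RintegralD// IH2.
rewrite (_ : EFin \o _ = (EFin \o h i) \+ (EFin \o (fun x => \sum_(j <- s) h j x)%R))%E//.
exact: integrableD.
Qed.

Definition gram : 'M[R]_k := \matrix_(i, j) \int[nu]_x (b i x * b j x).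

Lemma gram_form c c' : \int[nu]_x (lin_comb c x * lin_comb c' x) =
  \sum_i \sum_j c i * gram i j * c' j.
Proof.
have ib i j : nu.-integrable [set: M] (EFin \o (fun x => c i * c' j * (b i x * b j x))).
  rewrite (_ : EFin \o _ = (fun x => (c i * c' j)%:E * (EFin \o (b i \* b j)%R) x))%E//.
  by apply: integrableZl => //; exact: Lfun2_mul_integrable.
transitivity (\int[nu]_x (\sum_i \sum_j c i * c' j * (b i x * b j x))).
  apply: eq_Rintegral => x _; rewrite /lin_comb mulr_suml; apply: eq_bigr => i _.
  by rewrite mulr_sumr; apply: eq_bigr => j _; ring.
have [_ ->] := Rintegral_sum_integrable (index_enum _)
  (fun i => proj1 (Rintegral_sum_integrable (index_enum _) (ib i))).
apply: eq_bigr => i _; have [_ ->] := Rintegral_sum_integrable (index_enum _) (ib i).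
apply: eq_bigr => j _; rewrite RintegralZl//; last exact: Lfun2_mul_integrable.
by rewrite mxE; ring.
Qed.

(** The Gram matrix is positive definite: a combination of zero norm vanishes almost everywhere, so
    its coefficients are zero by independence. [orthonormal_family] supplies the coefficients. *)
Lemma orthonormal_combinations : exists C : 'I_k -> 'I_k -> R,
  forall i j, \int[nu]_x (lin_comb (C i) x * lin_comb (C j) x) = (i == j)%:R.
Proof.
have Gsym : gram^T = gram.
  apply/matrixP => i j; rewrite !mxE; apply: eq_Rintegral => x _; exact: mulrC.
have form (v w : 'rV[R]_k) : (v *m gram *m w^T) 0 0 =
    \int[nu]_x (lin_comb (v 0) x * lin_comb (w 0) x).
  rewrite gram_form mxE exchange_big/=; apply: eq_bigr => j _.
  by rewrite !mxE mulr_suml.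
have Gpos (v : 'rV[R]_k) : v != 0 -> 0 < (v *m gram *m v^T) 0 0.
  move=> v0; rewrite form lt0r Rintegral_ge0 ?andbT => [|x _]; last first.
    by rewrite -expr2 sqr_ge0.
  apply: contra_neq v0 => int0; apply/rowP => i; rewrite mxE.
  apply: (bfree (c := v 0)).
  have Lv := Lfun_lin_comb (v 0); have iv := Lfun2_mul_integrable Lv Lv.
  pose h := lin_comb (v 0) \* lin_comb (v 0).
  have mv : measurable_fun [set: M] (EFin \o h).
    by apply/measurable_EFinP; apply: measurable_funM; exact: Lfun2_measurable.
  have := proj1 (ae_eq_integral_abs nu measurableT mv).
  have -> : (\int[nu]_x `|(EFin \o h) x| = 0)%E.
    rewrite (eq_integral (EFin \o h)).
      by rewrite -[LHS]fineK ?integrable_fin_num//; congr EFin.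
    by move=> x _; rewrite /= ger0_norm//; exact: (sqr_ge0 (lin_comb (v 0) x)).
  move=> /(_ erefl); apply: filterS => x /(_ I) /= [] /eqP.
  by rewrite mulf_eq0 orbb => /eqP.
have [C CG] := orthonormal_family Gsym Gpos (leqnn k).
exists (fun i => C i) => i j.
have := form (row i C) (row j C).
rewrite (_ : (row i C *m gram *m (row j C)^T) 0 0 = (i == j)%:R).
  move=> ->; apply: eq_Rintegral => x _.
  by congr (_ * _); apply: eq_bigr => l _; rewrite mxE.
by rewrite tr_row -row_mul colE mulmxA -colE -row_mul CG !mxE.
Qed.

End gram.

Section final.
Context d dO (R : realType) (M : measurableType d) (Omega : measurableType dO).
Variables (mu : probability M R) (P : R.-pker M ~> M).
Variables (PP : M -> probability Omega R).
Variables (Z : nat -> Omega -> M) (PPZ : is_markov_chain P PP Z).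
Variables (V : set M) (mV : measurable V).
Hypothesis V0 : (0 < mu V)%E.
Hypothesis Prev : reversible mu P.
Variables (k : nat) (k0 : (0 < k)%N).
Local Notation nu := (steklov_nu mu mV).
Local Notation J := (edge_int mu P).
Local Notation F := (hitting_extension PP Z V).
Local Notation K := (steklov_kernel P PP Z V).
Local Notation c := (fine (mu V)).

Let c_gt0 : 0 < c.
Proof. by rewrite fine_gt0// V0 ltey_eq fin_num_measure. Qed.

Lemma eq_Rint_nu (g h : M -> R) : bmeas g -> bmeas h -> (forall x, V x -> g x = h x) ->
  \int[nu]_x g x = \int[nu]_x h x.
Proof.
move=> bg bh gh; apply: (mulfI (lt0r_neq0 c_gt0)).
rewrite -!Rint_nu// !Rint_restr//; apply: eq_Rintegral => x _.
rewrite indicE; have [Vx|Vx] := pselect (V x); first by rewrite gh.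
by rewrite memNset// !mul0r.
Qed.

(** The tolerance on the Gram matrix is of order k^-3 because k^2 entries add up in [iso], where a
    total error 1/(16k) is allowed. *)
Lemma cheeger_le_of_orthonormal (g : 'I_k -> M -> R) (s : R) : 0 < s ->
  (forall i, bmeas (g i)) ->
  (forall i j, `|\int[nu]_x (g i x * g j x) - (i == j)%:R| <= (16 * k%:R ^+ 3)^-1) ->
  (forall i, \int[nu]_x (g i x * (g i x - K (g i) x)) <= s) ->
  (cheeger_steklov mu P V k <= (8 * energy_cst R * k%:R ^+ 6 * s)%:E)%E.
Proof.
move=> s0 bg orth en.
have kR : 1 <= k%:R :> R by rewrite ler1n.
have k3 : 0 < 16 * k%:R ^+ 3 :> R by rewrite mulr_gt0 ?exprn_gt0 ?ltr0n.
pose eta : R := (16 * k%:R ^+ 3)^-1; have eta0 : 0 < eta by rewrite invr_gt0.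
pose G i := F (g i).
have bG i : bmeas (G i) by have [_ bF _ _] := hitting_extension_bmeas PPZ mV (bg i).
have Gg i x : V x -> G i x = g i x.
  by have [_ _ FV _] := hitting_extension_bmeas PPZ mV (bg i); exact: FV.
have GG i j : \int[nu]_x (G i x * G j x) = \int[nu]_x (g i x * g j x).
  by apply: eq_Rint_nu => [||x Vx]; [exact: bmeasM|exact: bmeasM|rewrite !Gg].
have iso (w : 'I_k -> R) : \sum_i w i ^+ 2 = 1 ->
    \int[nu]_x (\sum_i w i * G i x) ^+ 2 <= 1 + (16 * k%:R)^-1.
  move=> w1.
  have wle i : `|w i| <= 1.
    rewrite -(expr_le1 (ltn0Sn 1))// real_normK ?num_real// -w1.
    by rewrite (bigD1 i)//= lerDl sumr_ge0// => j _; exact: sqr_ge0.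
  have bw i j : bmeas (fun x => w i * w j * (G i x * G j x)).
    by apply: bmeasM; [exact: bmeas_cst|exact: bmeasM].
  have -> : \int[nu]_x (\sum_i w i * G i x) ^+ 2 =
      \sum_i \sum_j w i * w j * \int[nu]_x (g i x * g j x).
    transitivity (\int[nu]_x (\sum_i \sum_j w i * w j * (G i x * G j x))).
      apply: eq_Rintegral => x _; rewrite expr2 mulr_suml; apply: eq_bigr => i _.
      by rewrite mulr_sumr; apply: eq_bigr => j _; ring.
    rewrite (Rint_sum (prob_fin nu)) => [|i]; last exact: bmeas_sum.
    apply: eq_bigr => i _; rewrite (Rint_sum (prob_fin nu))//.
    by apply: eq_bigr => j _; rewrite (RintZ (prob_fin nu)) ?GG//; exact: bmeasM.
  apply: (@le_trans _ _ (\sum_i \sum_j (w i * w j * (i == j)%:R + eta))).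
    apply: ler_sum => i _; apply: ler_sum => j _.
    rewrite -lerBlDl -mulrBr; apply: le_trans (ler_norm _) _.
    rewrite normrM -[leRHS]mul1r ler_pM// ?orth// normrM.
    by rewrite -[leRHS]mulr1 ler_pM.
  under eq_bigr do rewrite big_split/=.
  rewrite big_split/=; apply: lerD.
    rewrite -[leRHS]w1 le_eqVlt; apply/orP; left; apply/eqP; apply: eq_bigr => i _.
    rewrite (bigD1 i)//= eqxx /= mulr1 big1 ?addr0 ?expr2// => j.
    by rewrite eq_sym => /negPf -> /=; rewrite mulr0.
  rewrite !sumr_const !card_ord -mulrnA -[leLHS]mulr_natr natrM.
  rewrite le_eqVlt; apply/orP; left; apply/eqP.
  by rewrite /eta; field; rewrite gt_eqF// ltr0n.
have tot : k%:R - 16^-1 <= \int[nu]_x \sum_i G i x ^+ 2.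
  rewrite (Rint_sum (prob_fin nu)) => [|i]; last exact: bmeasX.
  have -> : k%:R - 16^-1 = \sum_(i < k) (1 - 16^-1 / k%:R) :> R.
    rewrite sumr_const card_ord -[RHS]mulr_natr; field.
    by rewrite gt_eqF// ltr0n.
  apply: ler_sum => i _; under eq_Rintegral do rewrite expr2.
  rewrite GG; have := orth i i; rewrite eqxx/= ler_norml => /andP[h _].
  have : (16 * k%:R ^+ 3)^-1 <= 16^-1 / k%:R :> R.
    rewrite -invfM lef_pV2 ?posrE ?mulr_gt0 ?ltr0n// ler_pM2l ?ltr0n//.
    by rewrite -[leLHS]expr1 ler_weXn2l.
  lra.
(* The energy lives on [mu], the Rayleigh quotient on the normalized [nu]: this is the factor c =
   mu(V), which cancels against the mass c / 2 below. *)
have energy : \sum_i J (fun z => (G i z.1 - G i z.2) ^+ 2) <= 2 * k%:R * (c * s).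
  have -> : 2 * k%:R * (c * s) = \sum_(i < k) (2 * (c * s)).
    by rewrite sumr_const card_ord -[RHS]mulr_natr; ring.
  apply: ler_sum => i _; rewrite (energy_identity PPZ mV Prev (bg i)).
  rewrite ler_pM2l// Rint_nu//; last first.
    by apply: bmeasM => //; apply: bmeasB => //; exact: bmeas_steklov_kernel.
  by rewrite ler_pM2l.
have cs0 : 0 < c * s by rewrite mulr_gt0.
have [psi [bpsi psi0 disj mass Epsi]] :=
  localization (prob_fin nu) k0 bG cs0 iso tot energy.
have massV l : c / 2 <= \int[mrestr mu mV]_x psi l x ^+ 2.
  rewrite Rint_nu//; last exact: bmeasX.
  by rewrite ler_pM2l// -div1r.
have test l := cheeger_test Prev (bpsi l) (psi0 l)
  (lt_le_trans (divr_gt0 c_gt0 (ltr0Sn R 1)) (massV l)).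
pose A l := [set x | 0 < psi l x].
apply: (@le_trans _ _ (\big[maxe/-oo]_(l < k) mule_top (rho mu P (A l)) (rho' mu P V (A l)))%E).
  apply: ereal_inf_lbound; exists A => //; split=> [l|]; first exact: (proj1 (test l)).
  by apply/trivIsetP => l l' _ _ ll'; apply/seteqP; split=> // x [] /=;
    move=> h1 h2; move/eqP: ll'; apply; exact: disj h1 h2.
apply: bigmax_le => [|l _]; first exact: leNye.
apply: le_trans (proj2 (test l)) _; rewrite lee_fin.
have b0 : 0 < \int[mrestr mu mV]_x psi l x ^+ 2.
  exact: lt_le_trans (divr_gt0 c_gt0 (ltr0Sn R 1)) (massV l).
rewrite ler_pdivrMr//.
(* The 8 is the factor 4 of [cheeger_test] divided by the mass fraction 1/2. *)
apply: (@le_trans _ _ (8 * energy_cst R * k%:R ^+ 6 * s * (c / 2))); last first.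
  apply: ler_wpM2l (massV l); apply: mulr_ge0 (ltW s0).
  apply: mulr_ge0 (exprn_ge0 6 (ler0n R k)).
  exact: mulr_ge0 (ler0n R 8) (ltW (energy_cst_gt0 R)).
apply: (@le_trans _ _ (4 * (energy_cst R * k%:R ^+ 6 * (c * s)))).
  by rewrite ler_pM2l.
by rewrite le_eqVlt; apply/orP; left; apply/eqP; field.
Qed.

(** Each vector of an orthonormal basis of the test space has Rayleigh quotient at most S. Clipping
    at a high level changes these k quotients and the k^2 inner products arbitrarily little. *)
Lemma minmax_sigma_ge :
  (((8 * energy_cst R)^-1 / k%:R ^+ 6)%:E * cheeger_steklov mu P V k
    <= minmax_sigma nu K k)%E.
Proof.
have A0 := energy_cst_gt0 R.
apply: le_ereal_inf_tmp => _ [H [b [bL bfree HE]] <-].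
set S := ereal_sup _.
have [C orth] := orthonormal_combinations bL bfree.
pose f i := lin_comb b (C i).
have fL i : f i \in Lfun nu 2%:E by exact: Lfun_lin_comb.
have mf i := Lfun2_measurable (fL i).
have norm1 i : \int[nu]_x (f i x ^+ 2) = 1.
  by under eq_Rintegral do rewrite expr2; rewrite orth eqxx.
have f2 i : nu.-integrable setT (EFin \o (fun x => f i x ^+ 2)) by exact: Lfun2_integrable_sqr.
pose q i := \int[nu]_x (f i x * (f i x - K (f i) x)).
have qS i : ((q i)%:E <= S)%E.
  apply: ereal_sup_ubound; exists (f i); last by rewrite /rayleigh norm1 divr1.
  split.
    rewrite HE; split=> //; exists (C i); exact: aeW.
  move=> f0; have := norm1 i; rewrite /Rintegral.
  rewrite (@ae_eq_integral _ _ _ nu setT (cst 0%E)) ?integral_cst ?mul0e//=.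
  - by move/esym/eqP; rewrite oner_eq0.
  - exact: (measurable_int _ (f2 i)).
  - by apply: filterS f0 => x -> _; rewrite expr0n.
have lim i : \int[nu]_x (clip n (f i) x * (clip n (f i) x - K (clip n (f i)) x)) @[n --> \oo]
    --> q i by exact: energy_limit.
have glim i j : \int[nu]_x (clip n (f i) x * clip n (f j) x) @[n --> \oo]
    --> ((i == j)%:R : R).
  by rewrite -orth; apply: cvg_Rint_clipM => //; exact: Lfun2_mul_integrable.
have [->|SNy] := eqVneq S +oo%E; first exact: leey.
have Sfin : S \is a fin_num.
  (* The supremum is not over the empty set, as k >= 1 provides a basis vector. *)
  rewrite fin_numE SNy andbT; apply/eqP => SE.
  by have := qS (Ordinal k0); rewrite SE leeNy_eq.
apply/lee_addgt0Pr => e e0; rewrite -(fineK Sfin) -EFinD.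
set s := fine S.
have kR0 : 0 < k%:R :> R by rewrite ltr0n.
have eta0 : 0 < (16 * k%:R ^+ 3)^-1 :> R by rewrite invr_gt0 mulr_gt0 ?exprn_gt0.
have e2 : 0 < e / 2 by rewrite divr_gt0.
have near1 : \forall n \near \oo, forall i : 'I_k,
    `|q i - \int[nu]_x (clip n (f i) x * (clip n (f i) x - K (clip n (f i)) x))| <= e / 2.
  by apply: filter_forall => i; move/cvgrPdist_le: (lim i); exact.
have near2 : \forall n \near \oo, forall ij : 'I_k * 'I_k,
    `|(ij.1 == ij.2)%:R - \int[nu]_x (clip n (f ij.1) x * clip n (f ij.2) x)|
      <= (16 * k%:R ^+ 3)^-1.
  by apply: filter_forall => ij; move/cvgrPdist_le: (glim ij.1 ij.2); exact.
have [n [h1 h2]] := filter_ex (filterI near1 near2).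
have bc i : bmeas (clip n (f i)) by exact: bmeas_clip.
have en i : \int[nu]_x (clip n (f i) x * (clip n (f i) x - K (clip n (f i)) x)) <= s + e / 2.
  have := h1 i; rewrite distrC ler_norml => /andP[_].
  have : q i <= s by rewrite -lee_fin (fineK Sfin); exact: qS.
  lra.
(* S may be 0, whereas the localization requires a positive level. The clipped energies are
   nonnegative and at most s + e/2, so the remaining e/2 gives strict positivity. *)
have se0 : 0 < s + e.
  apply: (@le_lt_trans _ _ (s + e / 2)); last lra.
  apply: le_trans (en (Ordinal k0)); rewrite -(pmulr_rge0 _ c_gt0) -Rint_nu//; last first.
    by apply: bmeasM => //; apply: bmeasB => //; exact: bmeas_steklov_kernel.
  rewrite -(pmulr_rge0 _ (ltr0Sn R 1)) -(energy_identity PPZ mV Prev)//.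
  by apply: edge_int_ge0 => z; exact: sqr_ge0.
have main : (cheeger_steklov mu P V k <= (8 * energy_cst R * k%:R ^+ 6 * (s + e))%:E)%E.
  apply: (cheeger_le_of_orthonormal se0 bc) => [i j|i].
    by rewrite distrC; exact: (h2 (i, j)).
  by apply: le_trans (en i) _; lra.
apply: (@le_trans _ _ ((((8 * energy_cst R)^-1 / k%:R ^+ 6)%:E *
    (8 * energy_cst R * k%:R ^+ 6 * (s + e))%:E)%E)).
  apply: lee_wpmul2l => //; rewrite lee_fin divr_ge0 ?exprn_ge0 ?invr_ge0 ?mulr_ge0 ?ler0n//.
rewrite -EFinM lee_fin le_eqVlt; apply/orP; left; apply/eqP.
by field; rewrite !gt_eqF.
Qed.

End final.

Local Open Scope ereal_scope.

Theorem theorem2 (R : realType) :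
  exists2 c1 : R, (0 < c1)%R &
  forall (d : measure_display) (M : measurableType d) (mu : probability M R)
    (V : set M) (mV : measurable V) (V01 : 0 < mu V < 1)
    (P : R.-pker M ~> M) (Prev : reversible mu P)
    (dO : measure_display) (Omega : measurableType dO)
    (PP : M -> probability Omega R) (Z : nat -> Omega -> M)
    (PPZ : is_markov_chain P PP Z) (Pmix : weakly_mixing mu PP Z)
    (k : nat) (k1 : (1 <= k)%N),
  (c1 / k%:R ^+ 6)%:E * cheeger_steklov mu P V k
    <= minmax_sigma (steklov_nu mu mV) (steklov_kernel P PP Z V) k.
Proof.
exists ((8 * energy_cst R)^-1)%R.
  by rewrite invr_gt0 mulr_gt0 ?energy_cst_gt0.
move=> d M mu V mV /andP[V0 _] P Prev dO Omega PP Z PPZ _ k k1.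
exact: (minmax_sigma_ge PPZ mV V0 Prev k1).
Qed.
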